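(* \[ B^{(\mathrm{pk},\mathrm{des})}(x,y,t)=\exp\!\left(D^{t,x}\ln\!\left(1+\frac{(1+t)(1+u)v(w-1)}{yt(1+uv)(1-vw)}\right)\right), \] where \[ u=\frac{1+t^2-2yt-(1-t)\sqrt{(1+t)^2-4yt}}{2(1-y)t},\qquad v=\frac{(1+t)^2-2yt-(1+t)\sqrt{(1+t)^2-4yt}}{2yt}, \] and \[ w=\exp\!\left(\frac{x(1+u)(1-v)}{1+uv}\right). \]
   Context: For a permutation $\pi=\pi_1\cdots\pi_n$ of $[n]$, $\operatorname{des}(\pi)$ is the number of $1\le i\le n-1$ with $\pi_i>\pi_{i+1}$, $\operatorname{asc}(\pi)$ the number with $\pi_i<\pi_{i+1}$, and $\operatorname{pk}(\pi)$ the number of $2\le i\le n-1$ with $\pi_{i-1}<\pi_i>\pi_{i+1}$. A ballot permutation is one with $\operatorname{asc}(\pi_1\cdots\pi_i)\ge\operatorname{des}(\pi_1\cdots\pi_i)$ for all $i$; $\mathscr B_n$ is the set of ballot permutations of $[n]$, $\mathscr B_0=\{\epsilon\}$ (empty permutation, statistics $0$). $B^{(\mathrm{pk},\mathrm{des})}(x,y,t)=\sum_{n\ge0}\sum_{\pi\in\mathscr B_n} y^{\operatorname{pk}(\pi)}t^{\operatorname{des}(\pi)}\frac{x^n}{n!}$. For a multivariate formal power series $P=\sum p(n_1,\dots,n_k)x_1^{n_1}\cdots x_k^{n_k}$, the operator $D^{x_1,x_2}$ is defined by $D^{x_1,x_2}P=\sum_{n_1\le (n_2-1)/2}p(n_1,\dots,n_k)x_1^{n_1}\cdots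 x_k^{n_k}$, i.e. it keeps exactly the monomials in which the exponent of $x_1$ is at most (exponent of $x_2$ minus $1$)/2; here $D^{t,x}$ keeps monomials $x^n y^k t^d$ with $d\le (n-1)/2$. *)

(* Defs.v *)
From mathcomp Require Import all_boot all_order all_algebra all_fingroup.
Set Implicit Arguments. Unset Strict Implicit. Unset Printing Implicit Defensive.
Import Order.TTheory GRing.Theory Num.Theory.
Local Open Scope ring_scope.

Definition des_seq (s : seq nat) : nat :=
  count (fun i => nth 0%N s i.+1 < nth 0%N s i)%N (iota 0 (size s).-1).
Definition asc_seq (s : seq nat) : nat :=
  count (fun i => nth 0%N s i < nth 0%N s i.+1)%N (iota 0 (size s).-1).
(* peaks at (1-based) positions 2..n-1, i.e. 0-based i.+1 with 0 <= i < n-2 *)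
Definition pk_seq (s : seq nat) : nat :=
  count (fun i => (nth 0%N s i < nth 0%N s i.+1) && (nth 0%N s i.+2 < nth 0%N s i.+1))%N
        (iota 0 (size s - 2)).
Definition ballot_seq (s : seq nat) : bool :=
  all (fun i => des_seq (take i s) <= asc_seq (take i s))%N (iota 0 (size s).+1).

(* one-line notation of a permutation of 'I_n (values 0..n-1, i.e. [n] shifted) *)
Definition oneline n (s : 'S_n) : seq nat := [seq nat_of_ord (s i) | i <- enum 'I_n].

(** ** Formal power series in x, y, t: f n k d = coefficient of x^n y^k t^d. *)
Definition ps := nat -> nat -> nat -> rat.

Definition ps_const (c : rat) : ps :=
  fun n k d => if [&& n == 0, k == 0 & d == 0]%N then c else 0.
Definition ps_x : ps := fun n k d => ([&& n == 1, k == 0 & d == 0]%N)%:R.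
Definition ps_y : ps := fun n k d => ([&& n == 0, k == 1 & d == 0]%N)%:R.
Definition ps_t : ps := fun n k d => ([&& n == 0, k == 0 & d == 1]%N)%:R.
Definition ps_add (f g : ps) : ps := fun n k d => f n k d + g n k d.
Definition ps_opp (f : ps) : ps := fun n k d => - f n k d.
Definition ps_sub (f g : ps) : ps := ps_add f (ps_opp g).
Definition ps_scale (c : rat) (f : ps) : ps := fun n k d => c * f n k d.
Definition ps_mul (f g : ps) : ps := fun n k d =>
  \sum_(i < n.+1) \sum_(j < k.+1) \sum_(l < d.+1)
     f i j l * g (n - i)%N (k - j)%N (d - l)%N.
Definition ps_pow (f : ps) (m : nat) : ps := iter m (ps_mul f) (ps_const 1).

(* substitution of f (with zero constant term) into the univariate series
   sum_m a m z^m; for such f only m <= n+k+d contributes to x^n y^k t^d *)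
Definition ps_subst (a : nat -> rat) (f : ps) : ps := fun n k d =>
  \sum_(m < (n + k + d).+1) a m * ps_pow f m n k d.

(* exp F, for F with constant term 0 *)
Definition ps_exp (F : ps) : ps := ps_subst (fun m => (m`!)%:R^-1) F.
(* ln F = ln (1 + (F - 1)), for F with constant term 1 *)
Definition ps_ln (F : ps) : ps :=
  ps_subst (fun m => if m == 0%N then 0 else (-1) ^+ m.+1 / m%:R)
           (ps_sub F (ps_const 1)).
(* sqrt F = (1 + (F - 1))^(1/2) (binomial series), for F with constant term 1 *)
Definition ps_sqrt (F : ps) : ps :=
  ps_subst (fun m => (\prod_(i < m) (2^-1 - i%:R)) / (m`!)%:R)
           (ps_sub F (ps_const 1)).
(* 1 / F = 1 / (1 + (F - 1)), for F with constant term 1 *)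
Definition ps_inv (F : ps) : ps :=
  ps_subst (fun m => (-1) ^+ m) (ps_sub F (ps_const 1)).
Definition ps_div_t (f : ps) : ps := fun n k d => f n k d.+1.
Definition ps_div_y (f : ps) : ps := fun n k d => f n k.+1 d.

(* The operator D^{t,x}: keep monomials x^n y^k t^d with d <= (n-1)/2,
   i.e. 2d+1 <= n (equivalently 2d < n). *)
Definition D_tx (f : ps) : ps := fun n k d => if (d.*2 < n)%N then f n k d else 0.

Definition B_pkdes : ps := fun n k d =>
  (#|[set s : 'S_n | [&& ballot_seq (oneline s), pk_seq (oneline s) == k
                       & des_seq (oneline s) == d]]|)%:R / (n`!)%:R.

Definition ps_one : ps := ps_const 1.
Definition sqrt_term : ps :=
  ps_sqrt (ps_sub (ps_mul (ps_add ps_one ps_t) (ps_add ps_one ps_t))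
                  (ps_scale 4 (ps_mul ps_y ps_t))).
Definition u_ps : ps :=
  ps_scale 2^-1 (ps_div_t (ps_mul
    (ps_sub (ps_sub (ps_add ps_one (ps_mul ps_t ps_t)) (ps_scale 2 (ps_mul ps_y ps_t)))
            (ps_mul (ps_sub ps_one ps_t) sqrt_term))
    (ps_inv (ps_sub ps_one ps_y)))).
Definition v_ps : ps :=
  ps_scale 2^-1 (ps_div_y (ps_div_t
    (ps_sub (ps_sub (ps_mul (ps_add ps_one ps_t) (ps_add ps_one ps_t))
                    (ps_scale 2 (ps_mul ps_y ps_t)))
            (ps_mul (ps_add ps_one ps_t) sqrt_term)))).
Definition w_ps : ps :=
  ps_exp (ps_mul (ps_mul ps_x (ps_mul (ps_add ps_one u_ps) (ps_sub ps_one v_ps)))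
                 (ps_inv (ps_add ps_one (ps_mul u_ps v_ps)))).
Definition log_arg : ps :=
  ps_add ps_one (ps_div_y (ps_div_t (ps_mul
    (ps_mul (ps_mul (ps_add ps_one ps_t) (ps_add ps_one u_ps))
            (ps_mul v_ps (ps_sub w_ps ps_one)))
    (ps_inv (ps_mul (ps_add ps_one (ps_mul u_ps v_ps))
                    (ps_sub ps_one (ps_mul v_ps w_ps))))))).

(* Main.v *)
(** Give a word the heights [h_j = asc - des] of its nonempty prefixes.  A nonempty
    word with distinct letters has a unique last position of minimal height,
    followed by an ascent and a ballot word (or by nothing), and a unique first one,
    preceded by a descent unless the whole word is ballot.  Neither cut changes the
    number of peaks, since a ballot word of length at least 2 starts with an ascent
    and a word of length at least 2 ending at its minimal height ends with a descent.
    A cut at a descent loses a factor [t]; adding [t] times the first decomposition to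
    the second gives [1 + (1 + t) P = (1 + t M) B], where [P] is the series of
    nonempty permutations by peaks and descents and [M] that of the permutations
    ending at their minimal height.  Monomials of [B - 1] satisfy [2 d < n] and those
    of [t M] satisfy [2 d > n], so [D_tx] of the logarithm is [ln B].

    Removing the largest letter gives [dP/dx = 1 + (1 + t) P + y t P^2].  With
    [sigma = (1 + t + sqrt ((1 + t)^2 - 4 y t)) / 2] and [rho = 1 / sigma] one finds
    [1 + u v = (1 + u) rho] and [v = y t rho^2 = (1 + t) rho - 1], so that [log_arg] is
    [1 + (1 + t) G] with [G = rho (w - 1) / (1 - v w)], which solves the same equation. *)

From HB Require Import structures.
Require Import Defs.
From mathcomp Require Import all_boot all_order all_algebra all_fingroup.
From mathcomp Require Import boolp.
From mathcomp Require Import ring zify.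
Set Implicit Arguments. Unset Strict Implicit. Unset Printing Implicit Defensive.
Import Order.TTheory GRing.Theory Num.Theory.
Local Open Scope ring_scope.

(** * Univariate formal power series *)

Definition fps (R : Type) : Type := nat -> R.

Section FpsRing.
Variable R : comNzRingType.
Implicit Types f g h : fps R.

HB.instance Definition _ := gen_eqMixin (fps R).
HB.instance Definition _ := gen_choiceMixin (fps R).

Definition fps_zero : fps R := fun=> 0.
Definition fps_one : fps R := fun n => (n == 0)%:R.
Definition fps_opp f : fps R := fun n => - f n.
Definition fps_add f g : fps R := fun n => f n + g n.
Definition fps_mul f g : fps R := fun n => \sum_(i < n.+1) f i * g (n - i)%N.

Lemma fps_addA : associative fps_add.
Proof. by move=> f g h; apply: funext => n; rewrite /fps_add addrA. Qed.
Lemma fps_addC : commutative fps_add.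
Proof. by move=> f g; apply: funext => n; rewrite /fps_add addrC. Qed.
Lemma fps_add0 : left_id fps_zero fps_add.
Proof. by move=> f; apply: funext => n; rewrite /fps_add add0r. Qed.
Lemma fps_addN : left_inverse fps_zero fps_opp fps_add.
Proof. by move=> f; apply: funext => n; rewrite /fps_add addNr. Qed.

HB.instance Definition _ :=
  GRing.isZmodule.Build (fps R) fps_addA fps_addC fps_add0 fps_addN.

Let trunc n f : {poly R} := \poly_(i < n.+1) f i.

Lemma fps_mul_coef f g (p q : {poly R}) n :
  (forall i, (i <= n)%N -> f i = p`_i) -> (forall i, (i <= n)%N -> g i = q`_i) ->
  fps_mul f g n = (p * q)`_n.
Proof.
move=> fp gq; rewrite coefM; apply: eq_bigr => i _.
by rewrite fp ?gq ?leq_subr // -ltnS.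
Qed.

Let trunc_coef n f i : (i <= n)%N -> f i = (trunc n f)`_i.
Proof. by move=> le_in; rewrite coef_poly ltnS le_in. Qed.

Let fps_mul_trunc n f g i : (i <= n)%N -> fps_mul f g i = (trunc n f * trunc n g)`_i.
Proof.
by move=> le_in; apply: fps_mul_coef => j le_ji; apply: trunc_coef (leq_trans le_ji le_in).
Qed.

Lemma fps_mulA : associative fps_mul.
Proof.
move=> f g h; apply: funext => n.
rewrite (fps_mul_coef (@trunc_coef n f) (@fps_mul_trunc n g h)) mulrA.
by rewrite (fps_mul_coef (@fps_mul_trunc n f g) (@trunc_coef n h)).
Qed.
Lemma fps_mulC : commutative fps_mul.
Proof. by move=> f g; apply: funext => n; rewrite !(@fps_mul_trunc n) // mulrC. Qed.
Lemma fps_mul1 : left_id fps_one fps_mul.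
Proof.
move=> f; apply: funext => n; rewrite /fps_mul big_ord_recl big1 => [|i _].
  by rewrite /fps_one mul1r subn0 addr0.
by rewrite /fps_one mul0r.
Qed.
Lemma fps_mulDl : left_distributive fps_mul fps_add.
Proof.
move=> f g h; apply: funext => n; rewrite /fps_add /fps_mul -big_split.
by apply: eq_bigr => i _; rewrite mulrDl.
Qed.
Lemma fps_one_neq0 : fps_one != 0.
Proof. by apply/eqP => /(congr1 (@^~ 0%N)) /eqP; rewrite oner_eq0. Qed.

HB.instance Definition _ := GRing.Zmodule_isComNzRing.Build (fps R)
  fps_mulA fps_mulC fps_mul1 fps_mulDl fps_one_neq0.

Lemma fpsD f g n : (f + g) n = f n + g n. Proof. by []. Qed.
Lemma fpsN f n : (- f) n = - f n. Proof. by []. Qed.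
Lemma fpsM f g n : (f * g) n = \sum_(i < n.+1) f i * g (n - i)%N. Proof. by []. Qed.
Lemma fps1 n : (1 : fps R) n = (n == 0)%:R. Proof. by []. Qed.
Lemma fps0 n : (0 : fps R) n = 0. Proof. by []. Qed.
Lemma fps_sum (I : Type) (r : seq I) (P : pred I) (F : I -> fps R) n :
  (\sum_(i <- r | P i) F i) n = \sum_(i <- r | P i) F i n.
Proof. exact: (big_morph (fun f : fps R => f n)). Qed.

Definition mon a (r : R) : fps R := fun n => if n == a then r else 0.

Lemma monM a r f n : (mon a r * f) n = if (a <= n)%N then r * f (n - a)%N else 0.
Proof.
rewrite fpsM; case: leqP => [le_an|lt_na].
  rewrite (bigD1 (Ordinal (le_an : (a < n.+1)%N))) //= /mon eqxx big1 ?addr0 //.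
  by move=> i /negbTE ne_ia; rewrite -(inj_eq val_inj) /= in ne_ia; rewrite ne_ia mul0r.
rewrite big1 // => i _; rewrite /mon ltn_eqF ?mul0r //.
by rewrite (leq_ltn_trans _ lt_na) // -ltnS.
Qed.

Lemma monMmon a b r s : mon a r * mon b s = mon (a + b)%N (r * s).
Proof.
apply: funext => n; rewrite monM /mon; case: leqP => [le_an|lt_na].
  by rewrite -[in RHS](subnKC le_an) eqn_add2l; case: ifP; rewrite ?mulr0.
by rewrite ltn_eqF // (leq_trans lt_na) ?leq_addr.
Qed.

Lemma mon1 : mon 0 1 = 1.
Proof. by apply: funext => n; rewrite /mon fps1; case: eqP. Qed.

End FpsRing.

(** * Trivariate series, Euler derivations and substitution *)

(* Convertible to [ps], so that the series of Defs.v are elements of this ring after a cast. *)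
Definition fps3 := fps (fps (fps rat)).

Lemma fps3P (f g : fps3) : (forall n k d, f n k d = g n k d) -> f = g.
Proof.
by move=> fg; apply: funext => n; apply: funext => k; apply: funext => d.
Qed.

Definition mon3 n k d (c : rat) : fps3 := mon n (mon k (mon d c)).

Lemma mon3E a b e c n k d :
  mon3 a b e c n k d = if [&& n == a, k == b & d == e] then c else 0.
Proof. by rewrite /mon3 /mon; do 3!case: eqP => //=. Qed.

Lemma mon3M a b e c (f : fps3) n k d : (mon3 a b e c * f) n k d =
  if [&& a <= n, b <= k & e <= d]%N then c * f (n - a)%N (k - b)%N (d - e)%N else 0.
Proof. by rewrite /mon3; do 3!(rewrite monM; case: leqP => _ //=). Qed.

Lemma mon3Mmon a b e c a' b' e' c' :
  mon3 a b e c * mon3 a' b' e' c' = mon3 (a + a')%N (b + b')%N (e + e')%N (c * c').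
Proof. by rewrite /mon3 !monMmon. Qed.

Lemma mon3D a b e c c' : mon3 a b e (c + c') = mon3 a b e c + mon3 a b e c'.
Proof.
by apply: fps3P => n k d; rewrite !fpsD !mon3E; case: ifP; rewrite ?addr0.
Qed.

Lemma mon3_1 : mon3 0 0 0 1 = 1. Proof. by rewrite /mon3 !mon1. Qed.

Definition cst (c : rat) : fps3 := mon3 0 0 0 c.

Lemma cstM c (f : fps3) n k d : (cst c * f) n k d = c * f n k d.
Proof. by rewrite /cst mon3M /= !subn0. Qed.

Lemma cst_mul c c' : cst (c * c') = cst c * cst c'.
Proof. by rewrite /cst mon3Mmon. Qed.

Lemma cst1 : cst 1 = 1. Proof. exact: mon3_1. Qed.
Lemma cst0 : cst 0 = 0. Proof. by apply: fps3P => n k d; rewrite /cst mon3E if_same. Qed.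
Lemma cst_nat m : cst m%:R = m%:R.
Proof.
elim: m => [|m IHm]; first by rewrite cst0.
by rewrite -!natr1 [LHS]mon3D -/(cst _) IHm [X in _ + X]cst1.
Qed.
Lemma cstN c : cst (- c) = - cst c.
Proof. by apply/eqP; rewrite -addr_eq0 -mon3D addNr -/(cst 0) cst0. Qed.

Lemma fps3_1 n k d : (1 : fps3) n k d = [&& n == 0, k == 0 & d == 0]%:R.
Proof. by rewrite -mon3_1 mon3E; case: ifP. Qed.

Lemma natrM3 m (f : fps3) n k d : (m%:R * f) n k d = m%:R * f n k d.
Proof. by rewrite -cst_nat cstM. Qed.

Lemma mul3E (f g : fps3) n k d : (f * g) n k d =
  \sum_(i < n.+1) \sum_(j < k.+1) \sum_(l < d.+1)
     f i j l * g (n - i)%N (k - j)%N (d - l)%N.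
Proof.
rewrite fpsM !fps_sum; apply: eq_bigr => i _.
by rewrite fpsM fps_sum; apply: eq_bigr => j _; rewrite fpsM.
Qed.

Lemma eq_mul3r (f g h : fps3) n k d :
  (forall i j l, i <= n -> j <= k -> l <= d -> g i j l = h i j l)%N ->
  (f * g) n k d = (f * h) n k d.
Proof.
move=> gh; rewrite !mul3E; do 3!(apply: eq_bigr => ? _).
by rewrite gh ?leq_subr.
Qed.

Lemma mul3_000 (f g : fps3) : (f * g) 0 0 0 = f 0 0 0 * g 0 0 0.
Proof. by rewrite mul3E !big_ord1. Qed.

Definition euler (a b c : nat) (f : fps3) : fps3 :=
  fun n k d => (a * n + b * k + c * d)%:R * f n k d.

Section Euler.
Variables a b c : nat.
Local Notation th := (euler a b c).

Lemma eulerD f g : th (f + g) = th f + th g.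
Proof. by apply: fps3P => n k d; rewrite /euler !fpsD mulrDr. Qed.

Lemma eulerN f : th (- f) = - th f.
Proof. by apply: fps3P => n k d; rewrite /euler !fpsN mulrN. Qed.

Lemma euler_mon3 n k d e : th (mon3 n k d e) = cst (a * n + b * k + c * d)%:R * mon3 n k d e.
Proof.
apply: fps3P => n' k' d'; rewrite cstM /euler mon3E.
by case: ifP => [/and3P[/eqP-> /eqP-> /eqP->]|]; rewrite ?mulr0.
Qed.

Lemma euler_cst e : th (cst e) = 0.
Proof. by rewrite {1}/cst euler_mon3 !muln0 cst0 mul0r. Qed.

Lemma euler1 : th 1 = 0. Proof. by rewrite -cst1 euler_cst. Qed.

Lemma eulerM f g : th (f * g) = th f * g + f * th g.
Proof.
apply: fps3P => n k d; rewrite !fpsD {1}/euler !mul3E mulr_sumr -big_split /=.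
apply: eq_bigr => i _; rewrite mulr_sumr -big_split /=.
apply: eq_bigr => j _; rewrite mulr_sumr -big_split /=.
apply: eq_bigr => l _; rewrite /euler; have e p m (o : 'I_m.+1) : (p * m = p * o + p * (m - o))%N.
  by rewrite -mulnDr subnKC // -ltnS.
rewrite [in LHS](e a n i) [in LHS](e b k j) [in LHS](e c d l) !natrD.
by move: (f i j l) (g _ _ _) => x y; ring.
Qed.

Lemma eulerX f m : th (f ^+ m.+1) = m.+1%:R * f ^+ m * th f.
Proof.
elim: m => [|m IHm]; first by rewrite mulr1 mul1r.
by rewrite exprS eulerM IHm -(natr1 m.+1) !exprS; ring.
Qed.

Lemma euler_sum m (F : nat -> fps3) : th (\sum_(i < m) F i) = \sum_(i < m) th (F i).
Proof.
elim: m => [|m IHm]; last by rewrite !big_ord_recr /= eulerD IHm.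
by rewrite !big_ord0 -{1}cst0 euler_cst.
Qed.

End Euler.

Lemma ps_powE (f : fps3) m : ps_pow f m = f ^+ m.
Proof.
have mulE (g h : fps3) : ps_mul g h = g * h by apply: fps3P => n k d; rewrite mul3E.
elim: m => [|m IHm]; last by rewrite exprS -mulE -IHm.
by apply: fps3P => n k d; rewrite expr0 fps3_1 /ps_pow /= /ps_const; case: ifP.
Qed.

Lemma exp3_low (f : fps3) m n k d :
  f 0 0 0 = 0 -> (n + k + d < m)%N -> (f ^+ m) n k d = 0.
Proof.
move=> f0; elim: m n k d => // m IHm n k d lt_m; rewrite exprS mul3E.
rewrite big1 // => i _; rewrite big1 // => j _; rewrite big1 // => l _.
have [z|nz] := boolP [&& i == 0 :> nat, j == 0 :> nat & l == 0 :> nat].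
  by case/and3P: z => /eqP-> /eqP-> /eqP->; rewrite f0 mul0r.
rewrite IHm ?mulr0 //.
by have := ltn_ord i; have := ltn_ord j; have := ltn_ord l; lia.
Qed.

Section Subst.
Variable f : fps3.
Hypothesis f0 : f 0 0 0 = 0.
Local Notation subst a := (ps_subst a f : fps3).

Lemma subst_trunc N a n k d : (n + k + d < N)%N ->
  subst a n k d = (\sum_(m < N) cst (a m) * f ^+ m) n k d.
Proof.
move=> ltN; rewrite /ps_subst !fps_sum.
under [RHS]eq_bigr do rewrite cstM.
rewrite -(big_mkord xpredT (fun m => a m * (f ^+ m : fps3) n k d)).
rewrite (big_cat_nat (leq0n _) ltN) /= [X in _ + X]big_nat_cond [X in _ + X]big1 ?addr0.
  by rewrite big_mkord; apply: eq_bigr => i _; rewrite ps_powE.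
by move=> m; rewrite andbT => /andP[ltm _]; rewrite exp3_low ?mulr0.
Qed.

Lemma substS a : subst a = cst (a 0) + f * subst (fun m => a m.+1).
Proof.
apply: fps3P => n k d; rewrite (@subst_trunc (n + k + d).+2) //.
rewrite big_ord_recl mulr1 !fpsD; congr (_ + _).
rewrite (@eq_mul3r _ _ (\sum_(m < (n + k + d).+1) cst (a m.+1) * f ^+ m)).
  rewrite mulr_sumr; congr (fun g : fps3 => g n k d); apply: eq_bigr => i _.
  by rewrite exprS mulrCA.
by move=> i j l li lj ll; apply: subst_trunc; rewrite ltnS !leq_add.
Qed.

Lemma substD a b : subst (fun m => a m + b m) = subst a + subst b.
Proof.
apply: fps3P => n k d; rewrite !fpsD /ps_subst -big_split.
by apply: eq_bigr => i _; rewrite mulrDl.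
Qed.

Lemma substZ c a : subst (fun m => c * a m) = cst c * subst a.
Proof.
apply: fps3P => n k d; rewrite cstM /ps_subst mulr_sumr.
by apply: eq_bigr => i _; rewrite mulrA.
Qed.

Lemma subst_euler p q r a : euler p q r (subst a) =
  euler p q r f * subst (fun m => m.+1%:R * a m.+1).
Proof.
apply: fps3P => n k d; set N := (n + k + d).+1.
rewrite {1}/euler (@subst_trunc N.+1) ?ltnS //.
rewrite -[LHS]/(euler p q r (\sum_(m < N.+1) cst (a m) * f ^+ m) n k d).
rewrite (euler_sum _ _ _ _ (fun m => cst (a m) * f ^+ m)) big_ord_recl mulr1 euler_cst add0r.
rewrite (@eq_mul3r _ _ (\sum_(m < N) cst (m.+1%:R * a m.+1) * f ^+ m)).
  rewrite mulr_sumr; congr (fun g : fps3 => g n k d); apply: eq_bigr => i _.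
  by rewrite lift0 eulerM euler_cst mul0r add0r eulerX cst_mul cst_nat; ring.
by move=> i j l li lj ll; apply: subst_trunc; rewrite ltnS !leq_add.
Qed.

Lemma subst000 a : subst a 0 0 0 = a 0.
Proof. by rewrite substS !fpsD mul3_000 f0 mul0r addr0 /cst mon3E. Qed.

End Subst.

Lemma ps_subE (f g : fps3) : ps_sub f g = f - g. Proof. by []. Qed.
Lemma ps_constE c : ps_const c = cst c.
Proof. by apply: fps3P => n k d; rewrite /cst mon3E. Qed.

Lemma ps_invP (F : fps3) : F 0 0 0 = 1 -> F * ps_inv F = 1.
Proof.
move=> F1; rewrite /ps_inv ps_subE ps_constE cst1.
have f0 : (F - 1) 0 0 0 = 0 by rewrite !fpsD !fpsN F1 fps3_1 subrr.
move: (F - 1) f0 (subrK 1 F) => f f0 <-.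
pose I : fps3 := ps_subst (fun m => (-1) ^+ m) f.
have IE : I = 1 - f * I.
  rewrite {1}/I (substS f0) cst1 -mulrN; apply: congr1; apply: congr1.
  have -> : - I = cst (- 1) * I by rewrite cstN cst1 mulN1r.
  rewrite -(substZ f); apply: (congr1 (fun a => ps_subst a f)).
  by apply: funext => m; rewrite exprS.
by rewrite -/I mulrDl mul1r {2}IE; ring.
Qed.

Lemma eq_euler (A B : fps3) : A 0 0 0 = B 0 0 0 -> B 0 0 0 = 1 ->
  A * euler 1 1 1 B = B * euler 1 1 1 A -> A = B.
Proof.
move=> A0 B0 AB; pose I : fps3 := ps_inv B; have BI : B * I = 1 := ps_invP B0.
set th := euler 1 1 1 in AB.
have thI : B * th I = - th B * I.
  have : th (B * I) = 0 by rewrite BI /th euler1.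
  by rewrite /th eulerM => /eqP; rewrite addrC addr_eq0 mulNr => /eqP.
have th0 : th (A * I) = 0.
  have -> : th (A * I) = (B * I) * (B * I) * th (A * I) by rewrite BI !mul1r.
  have -> : th (A * I) = th A * I + A * th I by rewrite /th eulerM.
  have -> : B * I * (B * I) * (th A * I + A * th I) =
    I * I * (B * I * (B * th A) + A * B * (B * th I)) by ring.
  by rewrite thI -AB; ring.
have -> : A = A * I * B by rewrite -mulrA [I * B]mulrC BI mulr1.
suff -> : A * I = 1 by rewrite mul1r.
apply: fps3P => n k d; rewrite fps3_1.
have [/and3P[/eqP-> /eqP-> /eqP->]|nz] := boolP [&& n == 0, k == 0 & d == 0]%N.
  by have := congr1 (fun f : fps3 => f 0 0 0) BI; rewrite /= !mul3_000 fps3_1 A0.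
have /eqP := congr1 (fun f : fps3 => f n k d) th0.
rewrite /th /euler !fps0 mulf_eq0 pnatr_eq0 !mul1n !addn_eq0 -andbA (negbTE nz) /=.
by move/eqP.
Qed.

(** * Exponential, logarithm and square root *)

Lemma euler_inj (f g : fps3) :
  euler 1 1 1 f = euler 1 1 1 g -> f 0 0 0 = g 0 0 0 -> f = g.
Proof.
move=> fg fg0; apply: fps3P => n k d.
have [/and3P[/eqP-> /eqP-> /eqP->] //|nz] := boolP [&& n == 0, k == 0 & d == 0]%N.
have /mulfI := congr1 (fun f : fps3 => f n k d) fg; apply.
by rewrite pnatr_eq0 !mul1n !addn_eq0 -andbA.
Qed.

Lemma inv3_unique (A I J : fps3) : A * I = 1 -> A * J = 1 -> I = J.
Proof. by move=> AI AJ; rewrite -[LHS]mulr1 -AJ mulrCA mulrA AI mul1r. Qed.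

Section ExpLn.
Implicit Types F G : fps3.

Lemma exp_euler p q r F : F 0 0 0 = 0 ->
  euler p q r (ps_exp F) = euler p q r F * ps_exp F.
Proof.
move=> F0; rewrite /ps_exp (subst_euler F0); apply: congr1.
apply: (congr1 (fun a => ps_subst a F)); apply: funext => m.
by rewrite factS natrM invfM mulrA divff ?pnatr_eq0 // mul1r.
Qed.

Lemma exp3_000 F : F 0 0 0 = 0 -> ps_exp F 0 0 0 = 1.
Proof. by move=> F0; rewrite /ps_exp subst000 // invr1. Qed.

Lemma sub1_000 G : G 0 0 0 = 1 -> (G - 1) 0 0 0 = 0.
Proof. by move=> G1; rewrite !fpsD !fpsN fps3_1 G1 subrr. Qed.

Lemma euler_sub1 p q r G : euler p q r (G - 1) = euler p q r G.
Proof. by rewrite eulerD eulerN euler1 subr0. Qed.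

Lemma ln_euler p q r G : G 0 0 0 = 1 ->
  euler p q r (ps_ln G) = euler p q r G * ps_inv G.
Proof.
move=> G1; rewrite /ps_ln /ps_inv ps_subE ps_constE cst1.
rewrite (subst_euler (sub1_000 G1)) euler_sub1; apply: congr1.
apply: (congr1 (fun a => ps_subst a _)); apply: funext => m /=.
by rewrite mulrCA divff ?pnatr_eq0 // mulr1 !exprS mulrA mulrNN !mul1r.
Qed.

Lemma ln3_000 G : G 0 0 0 = 1 -> ps_ln G 0 0 0 = 0.
Proof.
by move=> G1; rewrite /ps_ln ps_subE ps_constE cst1 subst000 ?sub1_000.
Qed.

Lemma exp_lnK G : G 0 0 0 = 1 -> ps_exp (ps_ln G) = G.
Proof.
move=> G1; have L0 := ln3_000 G1; apply: eq_euler => //; first by rewrite exp3_000.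
rewrite exp_euler // ln_euler //; have := ps_invP G1.
move: (ps_inv G : fps3) (ps_exp (ps_ln G) : fps3) (euler _ _ _ G) => I E T GI.
by transitivity (G * I * (E * T)); [rewrite GI mul1r | ring].
Qed.

Lemma inv3_mul F G : F 0 0 0 = 1 -> G 0 0 0 = 1 ->
  ps_inv (F * G) = (ps_inv F : fps3) * (ps_inv G : fps3).
Proof.
move=> F1 G1; apply: (@inv3_unique (F * G)).
  by apply: ps_invP; rewrite mul3_000 F1 G1 mulr1.
by rewrite mulrACA (ps_invP F1) (ps_invP G1) mulr1.
Qed.

Lemma lnM F G : F 0 0 0 = 1 -> G 0 0 0 = 1 ->
  ps_ln (F * G) = (ps_ln F : fps3) + (ps_ln G : fps3).
Proof.
move=> F1 G1; have FG1 : (F * G) 0 0 0 = 1 by rewrite mul3_000 F1 G1 mulr1.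
apply: euler_inj; last by rewrite !fpsD !ln3_000 // addr0.
rewrite eulerD !ln_euler // inv3_mul // eulerM.
have := ps_invP F1; have := ps_invP G1.
move: (ps_inv F : fps3) (ps_inv G : fps3) => I J GJ FI.
transitivity (euler 1 1 1 F * I * (G * J) + euler 1 1 1 G * J * (F * I)).
  by ring.
by rewrite GJ FI !mulr1.
Qed.

Lemma sqrt3_000 F : F 0 0 0 = 1 -> ps_sqrt F 0 0 0 = 1.
Proof.
move=> F1; rewrite /ps_sqrt ps_subE ps_constE cst1 subst000 ?sub1_000 //.
by rewrite big_ord0 divr1.
Qed.

Lemma sqrt3_sqr F : F 0 0 0 = 1 -> (ps_sqrt F : fps3) ^+ 2 = F.
Proof.
move=> F1; have f0 := sub1_000 F1; have s1 := sqrt3_000 F1.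
pose s : fps3 := ps_sqrt F; rewrite -/s in s1 *.
apply: eq_euler => //; first by rewrite expr2 mul3_000 s1 mulr1.
suff sE : 2 * F * euler 1 1 1 s = s * euler 1 1 1 F.
  by rewrite eulerX !expr1; transitivity (s * (s * euler 1 1 1 F));
    [ring | rewrite -sE; ring].
pose a m : rat := (\prod_(i < m) (2^-1 - i%:R)) / (m`!)%:R.
pose b m := m.+1%:R * a m.+1.
have -> : s = ps_subst a (F - 1) by rewrite -cst1 -ps_constE.
rewrite (subst_euler f0) euler_sub1 -/b.
pose b1 m := if m is m'.+1 then b m' else 0.
have b1E : ps_subst b1 (F - 1) = (F - 1) * (ps_subst b (F - 1) : fps3).
  by rewrite (substS f0) cst0 add0r.
have abE : a = fun m => 2%:R * (b m + b1 m).
  have bE m : b m = (2^-1 - m%:R) * a m.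
    rewrite /b /a factS natrM invfM big_ord_recr /=.
    have m1 : m.+1%:R != 0 :> rat by rewrite pnatr_eq0.
    have f1 : m`!%:R != 0 :> rat by rewrite pnatr_eq0 -lt0n fact_gt0.
    by field; rewrite f1 nat1r m1.
  apply: funext => -[|m]; rewrite bE /=; first by field.
  by rewrite /b; field.
rewrite [in RHS]abE (substZ (F - 1)) (substD (F - 1)) b1E cst_nat.
by move: (ps_subst b (F - 1) : fps3) => B; ring.
Qed.

End ExpLn.

Section Support.
Variable S : nat -> nat -> nat -> bool.
Hypothesis S_add : forall n k d n' k' d',
  S n k d -> S n' k' d' -> S (n + n')%N (k + k')%N (d + d')%N.

Definition supported (f : fps3) := forall n k d, ~~ S n k d -> f n k d = 0.

Lemma supported_mul f g : supported f -> supported g -> supported (f * g).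
Proof.
move=> Sf Sg n k d nS; rewrite mul3E.
apply: big1 => i _; apply: big1 => j _; apply: big1 => l _.
have [Sijl|/Sf->] := boolP (S i j l); last by rewrite mul0r.
rewrite [g _ _ _]Sg ?mulr0 //; apply: contra nS => /(S_add Sijl).
by rewrite !subnKC // -ltnS.
Qed.

Lemma supported_subst a f : a 0%N = 0 -> supported f -> supported (ps_subst a f).
Proof.
move=> a0 Sf n k d nS; rewrite /ps_subst big_ord_recl a0 mul0r add0r.
apply: big1 => i _; rewrite lift0 ps_powE.
suff -> : (f ^+ i.+1) n k d = 0 by rewrite mulr0.
by move: (nat_of_ord i) => {}i; elim: i n k d nS => // m IHm; rewrite exprS; apply: supported_mul.
Qed.

Lemma supported_ln f : supported (f - 1) -> supported (ps_ln f).
Proof. by move=> Sf; apply: supported_subst; rewrite ?ps_subE ?ps_constE ?cst1. Qed.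

End Support.

(* N and B are the Wiener-Hopf factors of N * B, which D_tx separates after taking logarithms. *)
Lemma exp_D_ln (N B : fps3) : N 0 0 0 = 1 -> B 0 0 0 = 1 ->
  supported (fun n _ d => n < d.*2)%N (N - 1) ->
  supported (fun n _ d => d.*2 < n)%N (B - 1) ->
  ps_exp (D_tx (ps_ln (N * B))) = B.
Proof.
move=> N1 B1 SN SB; rewrite lnM //.
suff -> : D_tx ((ps_ln N : fps3) + (ps_ln B : fps3)) = ps_ln B by apply: exp_lnK.
apply: fps3P => n k d; rewrite /D_tx; case: ifPn => [lt_dn|nlt].
  rewrite !fpsD (supported_ln _ SN) ?add0r // -?leqNgt ?(ltnW lt_dn) //.
  by move=> *; rewrite doubleD; lia.
rewrite (supported_ln _ SB) //.
by move=> *; rewrite doubleD; lia.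
Qed.

(** * Sums over arrangements *)

Section Arrangements.
Variable K : comNzRingType.
Implicit Types (g phi psi : seq nat -> K) (s w : seq nat).

Definition tot g s : K := \sum_(w <- permutations s) g w.

Definition order_inv g := forall (f : nat -> nat) w,
  {in w &, {mono f : a b / (a < b)%N}} -> g [seq f i | i <- w] = g w.

Lemma tot_sorted g s : order_inv g -> sorted ltn s -> tot g s = tot g (iota 0 (size s)).
Proof.
move=> gP s_sorted; have s_uniq : uniq s by exact: (sorted_uniq ltn_trans ltnn).
have nth_homo := sorted_ltn_nth ltn_trans 0%N s_sorted.
have nth_mono : {in gtn (size s) &, {mono nth 0%N s : a b / (a < b)%N}}.
  move=> a b lt_a lt_b; case: (ltngtP a b) => [ab|ba|->]; last by rewrite ltnn.
    exact: nth_homo.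
  by apply: negbTE; rewrite -leqNgt ltnW //; apply: nth_homo.
have lt_w w : w \in permutations (iota 0 (size s)) -> {subset w <= gtn (size s)}.
  by rewrite mem_permutations => /perm_mem wP a; rewrite wP mem_iota.
transitivity (\sum_(w <- [seq map (nth 0%N s) w | w <- permutations (iota 0 (size s))]) g w).
  apply: perm_big; apply: uniq_perm; first exact: permutations_uniq.
    rewrite map_inj_in_uniq ?permutations_uniq // => v w /lt_w vP /lt_w wP.
    have idx (u : seq nat) : {subset u <= gtn (size s)} -> map (index^~ s) (map (nth 0%N s) u) = u.
      move=> uP; rewrite -map_comp; apply: map_id_in => a /uP lt_a /=.
      exact: index_uniq.
    by move/(congr1 (map (index^~ s))); rewrite !idx.
  move=> w; rewrite mem_permutations; apply/(perm_iotaP 0%N)/mapP => -[v vP ->];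
    by exists v; rewrite // mem_permutations in vP *.
rewrite big_map /tot big_seq [RHS]big_seq; apply: eq_bigr => w /lt_w wP.
by apply: gP => a b /wP aP /wP bP; apply: nth_mono.
Qed.

Definition splits n := [seq (take i w, drop i w) | w <- permutations (iota 0 n), i <- iota 0 n.+1].

Lemma mem_splits n p : (p \in splits n) = perm_eq (p.1 ++ p.2) (iota 0 n).
Proof.
apply/allpairsP/idP => [[[w i]] /= [] | ].
  by rewrite mem_permutations => w_perm _ ->; rewrite cat_take_drop.
move=> p_perm; exists (p.1 ++ p.2, size p.1); split.
- by rewrite mem_permutations.
- rewrite mem_iota leq0n add0n ltnS andTb -[n in (_ <= n)%N](size_iota 0).
  by rewrite -(perm_size p_perm) size_cat leq_addr.
by rewrite take_size_cat // drop_size_cat //; case: p p_perm.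
Qed.

Lemma splits_uniq n : uniq (splits n).
Proof.
apply: allpairs_uniq; rewrite ?permutations_uniq ?iota_uniq // => -[v i] [w j].
move=> /allpairsP[[v' i'] [v'P i'P [-> ->]]] /allpairsP[[w' j'] [w'P j'P [-> ->]]].
move: v'P i'P w'P j'P; rewrite /fst /snd => v'P i'P w'P j'P; case=> take_eq drop_eq.
have vw : v' = w' by rewrite -[v'](cat_take_drop i') take_eq drop_eq cat_take_drop.
congr (_, _) => //; move: take_eq => /(congr1 size).
move: v'P w'P i'P j'P; rewrite !mem_permutations => /perm_size v'n /perm_size w'n.
by rewrite !mem_iota !size_take_min v'n w'n size_iota; lia.
Qed.

Lemma sum_splits n (h : seq nat -> seq nat -> K) :
  \sum_(w <- permutations (iota 0 n)) \sum_(i < n.+1) h (take i w) (drop i w) =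
  \sum_(p <- splits n) h p.1 p.2.
Proof.
rewrite big_allpairs_dep; apply: eq_bigr => w _.
by rewrite -(big_mkord xpredT (fun i => h (take i w) (drop i w))) /index_iota subn0.
Qed.

Definition ord_vals n (A : {set 'I_n}) : seq nat := [seq val i | i <- enum A].

Lemma mem_ord_vals n (A : {set 'I_n}) (i : 'I_n) : (val i \in ord_vals A) = (i \in A).
Proof. by rewrite mem_map ?mem_enum //; apply: val_inj. Qed.

Lemma ord_vals_sorted n (A : {set 'I_n}) : sorted ltn (ord_vals A).
Proof.
have : subseq (ord_vals A) (iota 0 n).
  by rewrite -val_enum_ord map_subseq // [X in subseq _ X]enumT; apply: filter_subseq.
by move/(subseq_sorted ltn_trans); apply; apply: iota_ltn_sorted.
Qed.

Lemma ord_vals_uniq n (A : {set 'I_n}) : uniq (ord_vals A).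
Proof. by rewrite map_inj_uniq ?enum_uniq //; apply: val_inj. Qed.

Lemma tot_ord_vals n (A : {set 'I_n}) g : order_inv g -> tot g (ord_vals A) = tot g (iota 0 #|A|).
Proof. by move=> gP; rewrite (tot_sorted gP (ord_vals_sorted A)) size_map -cardE. Qed.

Lemma ord_vals_setC n (A : {set 'I_n}) : perm_eq (ord_vals A ++ ord_vals (~: A)) (iota 0 n).
Proof.
rewrite -val_enum_ord -map_cat perm_map //; apply: uniq_perm.
- rewrite cat_uniq !enum_uniq andbT; apply/hasPn => i.
  by rewrite !mem_enum inE.
- exact: enum_uniq.
by move=> i; rewrite mem_cat !mem_enum !inE orbN.
Qed.

Lemma sum_splits_set n phi psi : \sum_(p <- splits n) phi p.1 * psi p.2 =
  \sum_(A : {set 'I_n}) tot phi (ord_vals A) * tot psi (ord_vals (~: A)).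
Proof.
rewrite (partition_big (fun p => [set i : 'I_n | val i \in p.1]) xpredT) //=.
apply: eq_bigr => A _; rewrite -big_filter.
transitivity (\sum_(p <- [seq (v, w) | v <- permutations (ord_vals A),
    w <- permutations (ord_vals (~: A))]) phi p.1 * psi p.2); last first.
  rewrite big_allpairs_dep /tot big_distrl /=; apply: eq_bigr => v _.
  by rewrite big_distrr.
apply: perm_big; apply: uniq_perm; first by rewrite filter_uniq ?splits_uniq.
  by apply: allpairs_uniq; rewrite ?permutations_uniq // => -[? ?] [? ?] _ _ [-> ->].
move=> [v w]; rewrite mem_filter mem_splits /=.
apply/andP/allpairsP => [[/eqP AE vw_perm] | [[v' w'] /= []]]; last first.
  rewrite !mem_permutations => vP wP [-> ->]; split.
    by apply/eqP/setP => i; rewrite inE (perm_mem vP) mem_ord_vals.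
  by rewrite (perm_trans _ (ord_vals_setC A)) // perm_cat.
have vw_uniq : uniq (v ++ w) by rewrite (perm_uniq vw_perm) iota_uniq.
move: (vw_uniq); rewrite cat_uniq => /and3P[v_uniq /hasPn vw w_uniq].
exists (v, w); rewrite !mem_permutations.
split=> //; apply: uniq_perm; rewrite ?ord_vals_uniq // => a.
  have [lt_an|ge_an] := ltnP a n.
    by rewrite (mem_ord_vals A (Ordinal lt_an)) -AE inE.
  apply/idP/mapP => [av | [i _ ai]]; last by rewrite ai leqNgt ltn_ord in ge_an.
  have := perm_mem vw_perm a; rewrite mem_cat av mem_iota /= add0n.
  by rewrite ltnNge ge_an.
have [lt_an|ge_an] := ltnP a n.
  rewrite (mem_ord_vals (~: A) (Ordinal lt_an)) -AE !inE.
  have := perm_mem vw_perm a; rewrite mem_cat mem_iota /= add0n lt_an.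
  by have := vw a; case: (a \in w) (a \in v) => [|] [|] //= /(_ isT).
apply/idP/mapP => [aw | [i _ ai]]; last by rewrite ai leqNgt ltn_ord in ge_an.
have := perm_mem vw_perm a; rewrite mem_cat aw orbT mem_iota /= add0n.
by rewrite ltnNge ge_an.
Qed.

Lemma sum_card_set n (h : nat -> K) :
  \sum_(A : {set 'I_n}) h #|A| = \sum_(i < n.+1) 'C(n, i)%:R * h i.
Proof.
have ltA (A : {set 'I_n}) : (#|A| < n.+1)%N by rewrite ltnS -[n in (_ <= n)%N]card_ord max_card.
rewrite (partition_big (fun A => Ordinal (ltA A)) xpredT) //=; apply: eq_bigr => i _.
transitivity (\sum_(A : {set 'I_n} | #|A| == i) h i).
  apply: eq_big => [A|A]; first by rewrite -(inj_eq val_inj).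
  by rewrite -(inj_eq val_inj) => /eqP /= ->.
rewrite sumr_const -[n in 'C(n, _)]card_ord -card_draws mulr_natl; congr (_ *+ _).
by apply: eq_card => A; rewrite inE.
Qed.

Lemma sum_splits_binomial n phi psi : order_inv phi -> order_inv psi ->
  \sum_(p <- splits n) phi p.1 * psi p.2 =
  \sum_(i < n.+1) 'C(n, i)%:R * (tot phi (iota 0 i) * tot psi (iota 0 (n - i))).
Proof.
move=> phiP psiP; rewrite sum_splits_set.
rewrite -(sum_card_set n (fun i => tot phi (iota 0 i) * tot psi (iota 0 (n - i)))).
apply: eq_bigr => A _; rewrite !tot_ord_vals //.
suff -> : #|~: A| = (n - #|A|)%N by [].
by rewrite -[X in (X - _)%N]card_ord -(cardsC A) addKn.
Qed.

Lemma sum_insert_max n g : \sum_(w <- permutations (iota 0 n.+1)) g w =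
  \sum_(p <- splits n) g (p.1 ++ n :: p.2).
Proof.
rewrite -(big_map (fun p : seq nat * seq nat => p.1 ++ n :: p.2) xpredT g).
have nP p : p \in splits n -> n \notin p.1 ++ p.2.
  by rewrite mem_splits => /perm_mem->; rewrite mem_iota add0n ltnn.
apply: perm_big; apply: uniq_perm; first exact: permutations_uniq.
  rewrite map_inj_in_uniq ?splits_uniq // => -[v w] [v' w'] /nP /= np /nP /= np' eq_vw.
  have index_v (a b : seq nat) : n \notin a ++ b -> index n (a ++ n :: b) = size a.
    by rewrite mem_cat negb_or => /andP[na _]; rewrite index_cat (negbTE na) /= eqxx addn0.
  have sz : size v = size v' by rewrite -(index_v v w) // eq_vw index_v.
  by move/eqP: eq_vw; rewrite eqseq_cat // eqseq_cons eqxx => /andP[/eqP-> /eqP->].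
have iotaS : perm_eq (iota 0 n.+1) (n :: iota 0 n).
  by rewrite -addn1 iotaD add0n perm_catC.
move=> w; rewrite mem_permutations (permPr iotaS); apply/idP/mapP => [wP|[p]].
  have : n \in w by rewrite (perm_mem wP) inE eqxx.
  move=> /splitPr w12; case: w12 wP => w1 w2 wP; exists (w1, w2) => //.
  by rewrite mem_splits /= -(perm_cons n) -(permPr wP) perm_sym -[n :: w2]cat1s perm_catCA.
rewrite mem_splits => pP ->.
by rewrite -[n :: p.2]cat1s perm_catCA /= perm_cons.
Qed.

Lemma sum_oneline n g : \sum_(s : 'S_n) g (oneline s) = tot g (iota 0 n).
Proof.
rewrite /tot -(big_map (@oneline n) xpredT g); apply: perm_big.
have oneline_inj : injective (@oneline n).
  move=> s t; rewrite /oneline => /eq_in_map st; apply/permP => i.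
  by apply: val_inj; apply: st; rewrite mem_enum.
have uniq_l : uniq [seq oneline u | u <- index_enum ('S_n : finType)].
  by rewrite map_inj_uniq ?index_enum_uniq.
apply: uniq_perm => //; first exact: permutations_uniq.
have sub : {subset [seq oneline u | u <- index_enum ('S_n : finType)] <= permutations (iota 0 n)}.
  move=> w /mapP[s _ ->]; rewrite mem_permutations -val_enum_ord.
  rewrite /oneline (map_comp val s) perm_map //; apply: uniq_perm; rewrite ?enum_uniq //.
    by rewrite map_inj_uniq ?enum_uniq //; apply: perm_inj.
  by move=> i; rewrite mem_enum; apply/mapP; exists ((s^-1)%g i); rewrite ?mem_enum ?permKV.
have le_size : (size (permutations (iota 0 n)) <=
    size [seq oneline u | u <- index_enum ('S_n : finType)])%N.
  rewrite size_permutations ?iota_uniq // size_iota size_map -(card_Sn n).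
  by rewrite [index_enum _]unlock -enumT -cardE.
by case: (uniq_min_size uniq_l sub le_size).
Qed.

End Arrangements.

(** * Heights and weights of words *)

Lemma des_seq_cons2 a b s : des_seq [:: a, b & s] = ((b < a) + des_seq (b :: s))%N.
Proof. by rewrite /des_seq /= (iotaDl 1 0) count_map. Qed.

Lemma des_seq_cat s a b s' :
  des_seq (rcons s a ++ b :: s') = (des_seq (rcons s a) + (b < a) + des_seq (b :: s'))%N.
Proof.
elim: s => [|x [|z s] IHs]; first by rewrite /= des_seq_cons2.
  by rewrite /= !des_seq_cons2 /des_seq /=; lia.
by move: IHs; rewrite /= !des_seq_cons2 => ->; lia.
Qed.

Lemma pk_seq_cons3 a b c s :
  pk_seq [:: a, b, c & s] = (((a < b) && (c < b)) + pk_seq [:: b, c & s])%N.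
Proof. by rewrite /pk_seq /= !subSS !subn0 /= (iotaDl 1 0) count_map. Qed.

Lemma pk_seq_cat s a b s' :
  pk_seq (rcons s a ++ b :: s') = (pk_seq (rcons s a)
    + [&& s != [::], last 0 s < a & b < a] + [&& s' != [::], a < b & head 0 s' < b]
    + pk_seq (b :: s'))%N.
Proof.
have pk1 c : pk_seq [:: c] = 0%N by [].
have pk2 c d : pk_seq [:: c; d] = 0%N by [].
elim: s => [|x [|z [|u s]] IHs].
- by case: s' => [|c s']; rewrite /= ?pk_seq_cons3 ?pk1 ?pk2 //=; lia.
- by move: IHs; rewrite /= pk_seq_cons3 ?pk1 ?pk2 => ->; lia.
- by move: IHs; rewrite /= !pk_seq_cons3 => ->; lia.
by move: IHs; rewrite /= !pk_seq_cons3 => ->; lia.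
Qed.

Section OrderInvariance.
Variables (f : nat -> nat) (w : seq nat).
Hypothesis f_mono : {in w &, {mono f : a b / (a < b)%N}}.

Lemma nth_map_lt i j : (i < size w)%N -> (j < size w)%N ->
  (nth 0 (map f w) i < nth 0 (map f w) j)%N = (nth 0 w i < nth 0 w j)%N.
Proof. by move=> lt_i lt_j; rewrite !(nth_map 0%N) // f_mono ?mem_nth. Qed.

Lemma des_seq_map : des_seq (map f w) = des_seq w.
Proof.
rewrite /des_seq size_map; apply: eq_in_count => i; rewrite mem_iota => lt_i.
by apply: nth_map_lt; lia.
Qed.

Lemma pk_seq_map : pk_seq (map f w) = pk_seq w.
Proof.
rewrite /pk_seq size_map; apply: eq_in_count => i; rewrite mem_iota => lt_i.
by rewrite !nth_map_lt //; lia.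
Qed.

End OrderInvariance.

Definition step (w : seq nat) i : int :=
  (nth 0%N w i < nth 0%N w i.+1)%N%:Z - (nth 0%N w i.+1 < nth 0%N w i)%N%:Z.

Definition height w j : int := \sum_(0 <= i < j) step w i.

Lemma heightE w j : (j < size w)%N ->
  height w j = (asc_seq (take j.+1 w))%:Z - (des_seq (take j.+1 w))%:Z.
Proof.
move=> lt_j; rewrite /asc_seq /des_seq size_takel //=.
have countE p : (count p (iota 0 j))%:Z = \sum_(0 <= i < j) (p i)%:Z.
  rewrite -sum1_count big_mkcond (big_morph Posz PoszD (erefl _)) /index_iota subn0.
  by apply: eq_bigr => i _; case: (p i).
rewrite !countE -sumrB /height !big_nat; apply: eq_bigr => i lt_i.
by rewrite /step !nth_take //; lia.
Qed.

Lemma height_take w i j : (j < i)%N -> height (take i w) j = height w j.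
Proof.
move=> lt_ji; rewrite /height !big_nat; apply: eq_bigr => k lt_k.
by rewrite /step !nth_take //; lia.
Qed.

Lemma height_drop w i j : height w (i + j) = height w i + height (drop i w) j.
Proof.
rewrite /height (big_cat_nat _ (leq_addr j i)) //=; congr (_ + _).
rewrite -{1}[i]add0n big_addn addKn; apply: eq_bigr => k _.
by rewrite /step !nth_drop addnS addnC.
Qed.

Lemma height_map (f : nat -> nat) (w : seq nat) j :
  {in w &, {mono f : a b / (a < b)%N}} -> (j < size w)%N ->
  height (map f w) j = height w j.
Proof.
move=> f_mono lt_j; rewrite /height !big_nat; apply: eq_bigr => i lt_i.
by rewrite /step !(nth_map_lt f_mono) //; lia.
Qed.

Lemma step_uniq w i : uniq w -> (i.+1 < size w)%N ->
  step w i = if (nth 0 w i < nth 0 w i.+1)%N then 1 else -1.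
Proof.
move=> w_uniq lt_i; rewrite /step.
have : nth 0%N w i != nth 0%N w i.+1 by rewrite nth_uniq //; lia.
by case: ltngtP.
Qed.

Lemma ballot_height w : ballot_seq w = all (fun j => 0 <= height w j) (iota 0 (size w)).
Proof.
rewrite /ballot_seq /= (iotaDl 1 0) all_map take0 /=.
by apply: eq_in_all => j; rewrite mem_iota => lt_j; rewrite heightE //= add1n; lia.
Qed.

Lemma asc_add_des (w : seq nat) : uniq w -> (asc_seq w + des_seq w = (size w).-1)%N.
Proof.
move=> w_uniq; rewrite -[RHS](size_iota 0) -(count_predC (fun i => nth 0 w i < nth 0 w i.+1)%N).
congr (_ + _)%N; apply: eq_in_count => i; rewrite mem_iota => lt_i /=.
have lt_i1 : (i.+1 < size w)%N by lia.
have : nth 0%N w i != nth 0%N w i.+1 by rewrite nth_uniq ?ltn_eqF // ltnW.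
by case: ltngtP.
Qed.

Lemma height_last (w : seq nat) : w != [::] ->
  height w (size w).-1 = (asc_seq w)%:Z - (des_seq w)%:Z.
Proof. by case: w => // a w _; rewrite heightE //= take_size. Qed.

Definition ends_at_min w := all (fun j => height w (size w).-1 <= height w j) (iota 0 (size w)).

Lemma ends_at_min_des (w : seq nat) : uniq w -> w != [::] -> ends_at_min w ->
  (size w <= (des_seq w).*2.+1)%N.
Proof.
move=> w_uniq w_nil /allP /(_ 0%N); have := asc_add_des w_uniq.
have w_gt0 : (0 < size w)%N by case: (w) w_nil.
by rewrite mem_iota w_gt0 height_last // /height big_nil => sz_w /(_ isT); lia.
Qed.

Lemma ballot_des (w : seq nat) : uniq w -> w != [::] -> ballot_seq w ->
  ((des_seq w).*2 < size w)%N.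
Proof.
move=> w_uniq w_nil /allP /(_ (size w)); have := asc_add_des w_uniq.
have w_gt0 : (0 < size w)%N by case: (w) w_nil.
by rewrite mem_iota take_size leq0n ltnSn => sz_w /(_ isT); lia.
Qed.

Lemma sum_unique_min (K : nzRingType) (r : rel nat) n : transitive r ->
  (forall p j, p != j -> r p j = ~~ r j p) ->
  \sum_(p < n.+1) ([forall j : 'I_n.+1, (j != p) ==> r p j])%:R = 1 :> K.
Proof.
move=> r_trans r_total.
have [p pP] : exists p : 'I_n.+1, forall j : 'I_n.+1, j != p -> r p j.
  elim: n => [|n [p pP]]; first by exists ord0 => j; rewrite ord1 eqxx.
  have [rpn|nrpn] := boolP (r p n.+1).
    exists (widen_ord (leqnSn _) p) => j; rewrite -(inj_eq val_inj) /= => ne_jp.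
    have [->//|ne_jn] := eqVneq (j : nat) n.+1.
    have lt_j : (j < n.+1)%N by rewrite ltn_neqAle ne_jn -ltnS ltn_ord.
    by apply: (pP (Ordinal lt_j)); rewrite -(inj_eq val_inj).
  have rnp : r n.+1 p by rewrite r_total ?nrpn // gtn_eqF.
  exists ord_max => j; rewrite -(inj_eq val_inj) /= => ne_jn.
  have lt_j : (j < n.+1)%N by rewrite ltn_neqAle ne_jn -ltnS ltn_ord.
  have [->//|ne_jp] := eqVneq (j : nat) p.
  by apply: r_trans rnp _; apply: (pP (Ordinal lt_j)); rewrite -(inj_eq val_inj).
rewrite (bigD1 p) //= big1 ?addr0 => [|q ne_qp].
  by rewrite (_ : [forall _, _]) //; apply/forallP => j; apply/implyP; apply: pP.
rewrite (_ : [forall _, _] = false) //; apply/negP => /forallP /(_ p).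
by rewrite eq_sym ne_qp /= r_total // pP.
Qed.

Section WordWeights.
Variables (K : comNzRingType) (y t : K).
Implicit Types s w : seq nat.

Definition wt w : K := y ^+ pk_seq w * t ^+ des_seq w.
Definition wt_ballot w : K := if ballot_seq w then wt w else 0.
Definition wt_min w : K := if w == [::] then 1 else if ends_at_min w then t * wt w else 0.
Definition wt_nil w : K := (w == [::])%:R.
Definition wt_pos w : K := if w == [::] then 0 else wt w.

Lemma wt_cat_asc s a b s' : (a < b)%N -> ballot_seq (b :: s') ->
  wt (rcons s a ++ b :: s') = wt (rcons s a) * wt (b :: s').
Proof.
move=> ab s'_ballot; rewrite /wt des_seq_cat pk_seq_cat.
have -> : [&& s != [::], last 0 s < a & b < a]%N = false by lia.
have -> : [&& s' != [::], a < b & head 0 s' < b]%N = false.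
  case: s' s'_ballot => [//|c s'] /allP /(_ 2).
  by rewrite mem_iota /= take0 /des_seq /asc_seq /= => /(_ isT); lia.
by rewrite ltnNge (ltnW ab) !addn0 !exprD; ring.
Qed.

Lemma wt_cat_des s a b s' : (b < a)%N -> ends_at_min (rcons s a) ->
  wt (rcons s a ++ b :: s') = t * (wt (rcons s a) * wt (b :: s')).
Proof.
move=> ba s_min; rewrite /wt des_seq_cat pk_seq_cat.
have -> : [&& s' != [::], a < b & head 0 s' < b]%N = false by lia.
have -> : [&& s != [::], last 0 s < a & b < a]%N = false.
  case/lastP: s s_min => [//|s c] /allP /(_ (size s)).
  have -> : size s \in iota 0 (size (rcons (rcons s c) a)).
    by rewrite mem_iota !size_rcons; lia.
  rewrite !size_rcons => /(_ isT) /=.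
  rewrite /height big_nat_recr //= gerDl /step -!cats1 -catA !nth_cat ltnn subnn.
  by rewrite [((size s).+1 < size s)%N]ltnNge leqnSn /= subSnn last_cat /=; lia.
by rewrite ba !addn0 !exprD expr1; ring.
Qed.

Lemma wt_factor w : uniq w ->
  \sum_(i < (size w).+1) wt_min (take i w) * wt_ballot (drop i w) =
  if w == [::] then 1 else (1 + t) * wt w.
Proof.
have [->|w_nil w_uniq] := eqVneq w [::].
  by rewrite big_ord1 /wt_min /wt_ballot /= /wt mul1r mulr1.
case sz_w: (size w) => [|n]; first by rewrite (size0nil sz_w) in w_nil.
pose h := height w.
pose last_min p j := (h p < h j) || ((h p == h j) && (j < p)%N).
pose first_min p j := (h p < h j) || ((h p == h j) && (p < j)%N).
pose lmin p : K := ([forall j : 'I_n.+1, (j != p :> nat) ==> last_min p j])%:R.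
pose fmin p : K := ([forall j : 'I_n.+1, (j != p :> nat) ==> first_min p j])%:R.
have sum_lmin : \sum_(p < n.+1) lmin p = 1.
  by apply: sum_unique_min => [a b c|p j]; rewrite /last_min; lia.
have sum_fmin : \sum_(p < n.+1) fmin p = 1.
  by apply: sum_unique_min => [a b c|p j]; rewrite /first_min; lia.
pose L i := if i is p.+1 then lmin p else 0.
pose F i := if (i < n.+1)%N then fmin i else 0.
(* Cutting before [i] selects [i.-1] as last minimum if the cut is an ascent,
   and [i] as first minimum if it is a descent. *)
transitivity (\sum_(i < n.+2) wt w * (t * L i + F i)); last first.
  rewrite -mulr_sumr big_split /= -mulr_sumr big_ord_recl /= add0r sum_lmin.
  rewrite big_ord_recr /= /F ltnn addr0.
  under [X in _ + X]eq_bigr do rewrite ltn_ord.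
  by rewrite sum_fmin mulr1 addrC mulrC.
apply: eq_bigr => i _; have := ltn_ord i; move: (nat_of_ord i) => {}i lt_i.
have minE : (0 < i)%N -> ends_at_min (take i w) =
    [forall j : 'I_n.+1, (j < i)%N ==> (h i.-1 <= h j)].
  move=> i_gt0; rewrite /ends_at_min size_takel ?sz_w //.
  apply/allP/forallP => H j; last first.
    rewrite mem_iota => lt_j; have lt_jn : (j < n.+1)%N by lia.
    by have := H (Ordinal lt_jn); rewrite /h !height_take //=; lia.
  apply/implyP => lt_j; have := H j.
  by rewrite mem_iota !height_take //; [move/(_ lt_j) | lia].
have ballotE : (i <= n)%N -> ballot_seq (drop i w) =
    [forall j : 'I_n.+1, (i <= j)%N ==> (h i <= h j)].
  move=> le_i; rewrite ballot_height size_drop sz_w.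
  apply/allP/forallP => H j; last first.
    rewrite mem_iota => lt_j; have lt_jn : (i + j < n.+1)%N by lia.
    by have := H (Ordinal lt_jn); rewrite /= leq_addr /h height_drop lerDl.
  apply/implyP => le_ij; have := H (j - i)%N.
  rewrite mem_iota -[X in h i <= h X](subnKC le_ij) /h height_drop lerDl; apply.
  by have := ltn_ord j; lia.
have h0 : h 0%N = 0 by rewrite /h /height big_nil.
case: i => [|p] in lt_i minE ballotE *.
  rewrite take0 drop0 mul1r mulr0 add0r /F /fmin ltn0Sn /wt_ballot.
  rewrite -[in ballot_seq w](drop0 w) ballotE //.
  rewrite (_ : [forall _, _] = [forall j : 'I_n.+1, (j != 0%N :> nat) ==> first_min 0%N j]).
    by case: ifP; rewrite ?mulr1 ?mulr0.
  apply: eq_forallb => j; rewrite /first_min h0; case: (val j) => [|j']; last by lia.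
  by rewrite h0.
have take_nil : (take p.+1 w == [::]) = false by case: (w) w_nil.
rewrite /wt_min take_nil minE //= /F.
have [lt_p|ge_p] := ltnP p n.
  rewrite ltnS lt_p /wt_ballot ballotE //.
  have w_cat : w = rcons (take p w) (nth 0%N w p) ++ nth 0%N w p.+1 :: drop p.+2 w.
    by rewrite -take_nth -?drop_nth ?cat_take_drop ?sz_w // ltnW.
  have take_w : take p.+1 w = rcons (take p w) (nth 0%N w p).
    by rewrite -take_nth // sz_w ltnW.
  have drop_w : drop p.+1 w = nth 0%N w p.+1 :: drop p.+2 w.
    by rewrite -drop_nth // sz_w.
  have hS : h p.+1 = h p + if (nth 0 w p < nth 0 w p.+1)%N then 1 else -1.
    by rewrite /h /height big_nat_recr //= step_uniq // sz_w.
  have [asc|desc] := boolP (nth 0 w p < nth 0 w p.+1)%N.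
    rewrite asc in hS; rewrite /fmin (_ : [forall _, _ ==> first_min _ _] = false); last first.
      apply/negbTE/forallPn; have lt_pn : (p < n.+1)%N by rewrite ltnW.
      by exists (Ordinal lt_pn); rewrite /first_min /=; lia.
    rewrite addr0 /lmin.
    rewrite (_ : [forall _, _ ==> last_min _ _] =
      [forall j : 'I_n.+1, (j < p.+1)%N ==> (h p <= h j)] &&
      [forall j : 'I_n.+1, (p < j)%N ==> (h p.+1 <= h j)]); last first.
      apply/forallP/andP => [H|[/forallP H1 /forallP H2] j].
        by split; apply/forallP => j; have := H j; rewrite /last_min;
          have [->|] := eqVneq (j : nat) p; lia.
      by have := H1 j; have := H2 j; rewrite /last_min; lia.
    case: ifP => _ /=; last by rewrite mul0r !mulr0.
    case: ifP => B; last by rewrite !mulr0.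
    have Bd : ballot_seq (nth 0%N w p.+1 :: drop p.+2 w) by rewrite -drop_w ballotE.
    by rewrite [in RHS]w_cat wt_cat_asc // take_w drop_w mulr1; ring.
  rewrite (negbTE desc) in hS; rewrite /lmin (_ : [forall _, _ ==> last_min _ _] = false); last first.
    apply/negbTE/forallPn; have lt_pn : (p.+1 < n.+1)%N by [].
    by exists (Ordinal lt_pn); rewrite /last_min /=; lia.
  rewrite mulr0 add0r /fmin.
  rewrite (_ : [forall _, _ ==> first_min _ _] =
    [forall j : 'I_n.+1, (j < p.+1)%N ==> (h p <= h j)] &&
    [forall j : 'I_n.+1, (p < j)%N ==> (h p.+1 <= h j)]); last first.
    apply/forallP/andP => [H|[/forallP H1 /forallP H2] j].
      by split; apply/forallP => j; have := H j; rewrite /first_min;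
        have [->|] := eqVneq (j : nat) p.+1; lia.
    by have := H1 j; have := H2 j; rewrite /first_min; lia.
  case: ifP => M /=; last by rewrite mul0r !mulr0.
  case: ifP => B; last by rewrite !mulr0.
  have Md : ends_at_min (rcons (take p w) (nth 0%N w p)) by rewrite -take_w minE.
  have ba : (nth 0 w p.+1 < nth 0 w p)%N.
    have : nth 0%N w p != nth 0%N w p.+1 by rewrite nth_uniq ?sz_w //; lia.
    by move: desc; case: ltngtP.
  by rewrite [in RHS]w_cat wt_cat_des // take_w drop_w mulr1; ring.
have -> : p = n by apply/eqP; rewrite eqn_leq ge_p andbT -ltnS.
rewrite ltnn addr0 take_oversize ?sz_w // drop_oversize ?sz_w //.
rewrite /lmin (_ : [forall _, _ ==> last_min _ _] =
  [forall j : 'I_n.+1, (j < n.+1)%N ==> (h n <= h j)]); last first.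
  apply: eq_forallb => j; have := ltn_ord j; rewrite /last_min.
  by have [->|] := eqVneq (j : nat) n; lia.
have -> : wt_ballot [::] = 1 by rewrite /wt_ballot /wt /= mulr1.
by case: ifP => _; rewrite /= ?mul0r ?mulr0 ?mulr1 // mulrC.
Qed.

Lemma wt_insert_max s m s' : all (gtn m) s -> all (gtn m) s' ->
  wt (s ++ m :: s') = wt_nil s * wt_nil s' + t * (wt_nil s * wt_pos s') +
    wt_pos s * wt_nil s' + y * t * (wt_pos s * wt_pos s').
Proof.
have consE b u : (b < m)%N -> wt (m :: b :: u) = t * wt (b :: u).
  move=> bm; rewrite /wt des_seq_cons2 bm exprS.
  have -> : pk_seq [:: m, b & u] = pk_seq (b :: u); last by ring.
  by case: u => [//|c u]; rewrite pk_seq_cons3 ltnNge (ltnW bm).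
have wt1 : wt [:: m] = 1 by rewrite /wt /= mulr1.
case/lastP: s => [|s a].
  move=> _; case: s' => [_|b s' /andP[/= bm _]]; rewrite /wt_nil /wt_pos /=.
    by rewrite wt1; ring.
  by rewrite consE //; ring.
have -> : wt_nil (rcons s a) = 0 by rewrite /wt_nil; case: s.
have -> : wt_pos (rcons s a) = wt (rcons s a) by rewrite /wt_pos; case: s.
rewrite all_rcons => /andP[/= am _] s'm.
have -> : wt (rcons s a ++ m :: s') =
    y ^+ (s' != [::]) * (wt (rcons s a) * wt (m :: s')).
  have nma : (m < a)%N = false by rewrite ltnNge (ltnW am).
  rewrite /wt des_seq_cat pk_seq_cat nma /= !andbF !addn0.
  have -> : [&& s' != [::], a < m & head 0 s' < m]%N = (s' != [::]).
    by case: s' s'm => //= b s' /andP[-> _]; rewrite am.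
  by rewrite !exprD; ring.
case: s' s'm => [_|b s' /andP[/= bm _]]; rewrite /wt_nil /wt_pos /=.
  by rewrite wt1; ring.
by rewrite consE //; ring.
Qed.

Lemma wt_inv : order_inv wt.
Proof. by move=> f w f_mono; rewrite /wt des_seq_map // pk_seq_map. Qed.

Lemma map_nil_eq (f : nat -> nat) w : (map f w == [::]) = (w == [::]).
Proof. by case: w. Qed.

Lemma wt_pos_inv : order_inv wt_pos.
Proof. by move=> f w f_mono; rewrite /wt_pos map_nil_eq wt_inv. Qed.

Lemma wt_nil_inv : order_inv wt_nil.
Proof. by move=> f w f_mono; rewrite /wt_nil map_nil_eq. Qed.

Lemma wt_ballot_inv : order_inv wt_ballot.
Proof.
move=> f w f_mono; rewrite /wt_ballot wt_inv // !ballot_height size_map.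
congr (if _ then _ else _); apply: eq_in_all => j; rewrite mem_iota => lt_j.
by rewrite height_map.
Qed.

Lemma wt_min_inv : order_inv wt_min.
Proof.
move=> f w f_mono; rewrite /wt_min map_nil_eq wt_inv //.
case: eqVneq => // w_nil; congr (if _ then _ else _).
rewrite /ends_at_min size_map; apply: eq_in_all => j; rewrite mem_iota => lt_j.
by rewrite !height_map //; lia.
Qed.

End WordWeights.

(** * Exponential generating functions *)

Section Egf.
Variables (K : comNzRingType) (c : nat -> K).
Hypothesis cP : forall n, c n * n`!%:R = 1.
Implicit Types phi psi : seq nat -> K.

Definition egf phi : fps K := fun n => c n * tot phi (iota 0 n).

Lemma egfM phi psi n : order_inv phi -> order_inv psi ->
  (egf phi * egf psi) n = c n * \sum_(p <- splits n) phi p.1 * psi p.2.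
Proof.
move=> phiP psiP; rewrite sum_splits_binomial // mulr_sumr fpsM.
apply: eq_bigr => i _; have le_i : (i <= n)%N by rewrite -ltnS.
have cE : c n * 'C(n, i)%:R = c i * c (n - i)%N.
  transitivity (c n * 'C(n, i)%:R * (c i * i`!%:R) * (c (n - i)%N * (n - i)`!%:R)).
    by rewrite !cP !mulr1.
  transitivity (c n * ('C(n, i) * (i`! * (n - i)`!))%N%:R * (c i * c (n - i)%N)).
    by rewrite !natrM; ring.
  by rewrite bin_fact // cP mul1r.
by rewrite mulrA cE /egf; ring.
Qed.

Lemma c_succ n : c n.+1 *+ n.+1 = c n.
Proof.
transitivity (c n * (c n.+1 * n.+1`!%:R)); last by rewrite cP mulr1.
transitivity (c n * n`!%:R * (c n.+1 * n.+1%:R)); first by rewrite cP mul1r mulr_natr.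
by rewrite factS natrM; ring.
Qed.

Lemma egf_nil : egf (@wt_nil K) = 1.
Proof.
apply: funext => -[|n]; rewrite /egf /tot fps1.
  by rewrite big_seq1 /wt_nil eqxx mulr1 -[c 0](mulr1 _) -{1}[1]/(0`!%:R) cP.
rewrite big_seq big1 ?mulr0 // => w; rewrite mem_permutations => /perm_size.
by rewrite /wt_nil; case: w.
Qed.

Variables y t : K.

Lemma egf_wt_factor :
  1 + (1 + mon 0 t) * egf (wt_pos y t) = egf (wt_min y t) * egf (wt_ballot y t).
Proof.
apply: funext => n; rewrite egfM; [|exact: wt_min_inv|exact: wt_ballot_inv].
rewrite -(sum_splits n (fun v w => wt_min y t v * wt_ballot y t w)).
rewrite mulrDl mul1r !fpsD monM leq0n subn0 -egf_nil /egf /tot.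
rewrite [t * _]mulrCA -!mulrDr; apply: congr1.
rewrite mulr_sumr -!big_split /=; rewrite big_seq [RHS]big_seq; apply: eq_bigr => w.
rewrite mem_permutations => wP.
have w_uniq : uniq w by rewrite (perm_uniq wP) iota_uniq.
have := wt_factor y t w_uniq; rewrite (perm_size wP) size_iota => ->.
by rewrite /wt_nil /wt_pos; case: eqP => _; rewrite ?mulr1n ?mulr0n; ring.
Qed.

Lemma egf_wt_riccati n : egf (wt_pos y t) n *+ n =
  (mon 1 1 * (1 + (1 + mon 0 t) * egf (wt_pos y t)
    + mon 0 y * mon 0 t * egf (wt_pos y t) ^+ 2)) n.
Proof.
rewrite monM mul1r; case: n => [//|n]; rewrite subn1 /=.
rewrite /egf -mulrnAl c_succ {1}/tot.
rewrite (eq_big_seq (wt y t)) => [|w]; last first.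
  by rewrite mem_permutations /wt_pos => /perm_size; case: w.
rewrite sum_insert_max.
rewrite (eq_big_seq (fun p => wt_nil K p.1 * wt_nil K p.2 + t * (wt_nil K p.1 * wt_pos y t p.2)
   + wt_pos y t p.1 * wt_nil K p.2 + y * t * (wt_pos y t p.1 * wt_pos y t p.2))); last first.
  move=> p; rewrite mem_splits => /perm_mem pP; apply: wt_insert_max;
    by apply/allP => a ap; have := pP a; rewrite mem_cat ap ?orbT mem_iota.
rewrite !big_split /= -!mulr_sumr !mulrDr [c n * (t * _)]mulrCA [c n * (_ * _)]mulrCA.
have nP := @wt_nil_inv K; have pP := @wt_pos_inv K y t.
rewrite -(egfM n nP nP) -(egfM n nP pP) -(egfM n pP nP) -(egfM n pP pP).
rewrite egf_nil !mul1r mulr1 mulrDl mul1r -mulrA -expr2 !fpsD !monM !leq0n !subn0 /egf.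
by ring.
Qed.

End Egf.

Section PermutationSeries.

Let K := fps (fps rat).
Let c n : K := mon 0 (mon 0 (n`!%:R^-1)).
Let yK : K := mon 1 (mon 0 1).
Let tK : K := mon 0 (mon 1 1).

Lemma natmul2 (a : K) n k d : (a *+ n) k d = a k d *+ n.
Proof. by elim: n => // n IHn; rewrite !mulrS -IHn. Qed.

Lemma cM2 n (a : K) k d : (c n * a) k d = n`!%:R^-1 * a k d.
Proof. by rewrite /c monM leq0n monM leq0n !subn0. Qed.

Lemma cP2 n : c n * n`!%:R = 1.
Proof.
apply: funext => k; apply: funext => d; rewrite cM2 natmul2.
rewrite -[X in _ * X]mulr_natl mulrA mulVf ?mul1r //.
by rewrite pnatr_eq0 -lt0n fact_gt0.
Qed.

Lemma wt_coef w k d : wt yK tK w k d = ((pk_seq w == k) && (des_seq w == d))%:R.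
Proof.
have yX m : yK ^+ m = mon m (mon 0 1).
  elim: m => [|m IHm]; first by rewrite !mon1.
  by rewrite exprS IHm monMmon monMmon mulr1.
have tX m : tK ^+ m = mon 0 (mon m 1).
  elim: m => [|m IHm]; first by rewrite mon1 mon1.
  by rewrite exprS IHm monMmon monMmon mulr1.
rewrite /wt yX tX !monMmon mulr1 addn0 add0n /mon.
by rewrite ![_ == pk_seq _]eq_sym; case: eqP => //= _; rewrite eq_sym; case: eqP.
Qed.

Definition perm_egf : fps3 := egf c (wt_pos yK tK).
Definition min_egf : fps3 := egf c (wt_min yK tK).

Lemma B_pkdesE : B_pkdes = egf c (wt_ballot yK tK).
Proof.
apply: fps3P => n k d; rewrite /egf cM2 mulrC /B_pkdes; congr (_ / _).
rewrite -sum_oneline !fps_sum -sum1_card natr_sum big_mkcond /=.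
apply: eq_bigr => s _; rewrite inE /wt_ballot; case: ballot_seq => //=.
by rewrite wt_coef; case: ifP.
Qed.

Lemma perm_egf_factor : 1 + (1 + mon3 0 0 1 1) * perm_egf = min_egf * B_pkdes.
Proof. by rewrite B_pkdesE; apply: (egf_wt_factor cP2). Qed.

Lemma perm_egf_riccati : euler 1 0 0 perm_egf =
  mon3 1 0 0 1 * (1 + (1 + mon3 0 0 1 1) * perm_egf
    + mon3 0 1 0 1 * mon3 0 0 1 1 * perm_egf ^+ 2).
Proof.
apply: fps3P => n k d; have := egf_wt_riccati cP2 yK tK n.
move/(congr1 (fun f : K => f k d)); rewrite natmul2 -/perm_egf.
have -> : mon3 1 0 0 1 = mon 1 1 by rewrite /mon3 !mon1.
by rewrite /euler mul1n !mul0n !addn0 mulr_natl => ->.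
Qed.

Lemma egf_supported (S : nat -> nat -> nat -> bool) (g : seq nat -> K) : g [::] = 1 ->
  (forall (w : seq nat) k d, uniq w -> w != [::] -> ~~ S (size w) k d -> g w k d = 0) ->
  supported S ((egf c g : fps3) - 1).
Proof.
move=> g1 gP n k d nS; rewrite !fpsD !fpsN.
case: n => [|n] in nS *.
  rewrite /egf /tot big_seq1 g1 mulr1 /c fps3_1 /mon invr1.
  by case: (k == 0%N); case: (d == 0%N); rewrite subrr.
rewrite fps3_1 subr0 /egf cM2 /tot !fps_sum big_seq big1 ?mulr0 // => w.
rewrite mem_permutations => wP; have sz_w := perm_size wP; rewrite size_iota in sz_w.
apply: gP; rewrite ?sz_w //; first by rewrite (perm_uniq wP) iota_uniq.
by case: w sz_w {wP}.
Qed.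

Lemma min_egf_supported : supported (fun n _ d => n < d.*2)%N (min_egf - 1).
Proof.
apply: egf_supported => [//|w k d w_uniq w_nil le_dn].
rewrite /wt_min (negbTE w_nil); case: ifP => // w_min.
have := ends_at_min_des w_uniq w_nil w_min.
rewrite {1}/tK monM leq0n subn0 monM mul1r wt_coef; case: ltnP => // lt_d.
by case: eqP => //= _; case: eqP => // des_d le_w; exfalso; lia.
Qed.

Lemma B_pkdes_supported : supported (fun n _ d => d.*2 < n)%N ((B_pkdes : fps3) - 1).
Proof.
rewrite B_pkdesE; apply: egf_supported => [|w k d w_uniq w_nil le_nd].
  by rewrite /wt_ballot /wt /= mulr1.
rewrite /wt_ballot; case: ifP => // w_ballot.
have := ballot_des w_uniq w_nil w_ballot.
rewrite wt_coef; case: eqP => //= _; case: eqP => // des_d lt_w; exfalso; lia.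
Qed.

Lemma supported_000 S (f : fps3) : supported S (f - 1) -> ~~ S 0 0 0 -> f 0 0 0 = 1.
Proof.
move=> Sf nS; have /eqP := Sf 0 0 0 nS; rewrite !fpsD !fpsN fps3_1.
by rewrite subr_eq0 => /eqP.
Qed.

Lemma B_pkdes_exp_ln :
  B_pkdes = ps_exp (D_tx (ps_ln (1 + (1 + mon3 0 0 1 1) * perm_egf))).
Proof.
rewrite perm_egf_factor exp_D_ln //.
- exact: supported_000 min_egf_supported _.
- exact: supported_000 B_pkdes_supported _.
- exact: min_egf_supported.
exact: B_pkdes_supported.
Qed.

Lemma perm_egf0 : perm_egf 0%N = 0.
Proof. by rewrite /perm_egf /egf /tot big_seq1 /wt_pos mulr0. Qed.

End PermutationSeries.

(** * The closed form *)

Section SigmaIdentities.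
Variables (R : comNzRingType) (y t s h sg rho tau : R).
Hypotheses (h2 : 2 * h = 1) (s_sqr : s ^+ 2 = (1 + t) * (1 + t) - 4 * (y * t)).
Hypotheses (sgE : sg = h * (s + 1 + t)) (sg_rho : sg * rho = 1) (sgt_tau : (sg - t) * tau = 1).

Lemma s_sg : s = 2 * sg - 1 - t.
Proof. by rewrite sgE mulrA h2; ring. Qed.

Lemma sg_sqr : sg ^+ 2 = (1 + t) * sg - y * t.
Proof.
suff : 4 * sg ^+ 2 = 4 * ((1 + t) * sg - y * t).
  move/(congr1 ( *%R (h * h))).
  have h4 : h * h * 4 = 1 by transitivity (2 * h * (2 * h)); [ring | rewrite h2 mul1r].
  by rewrite !mulrA h4 !mul1r.
transitivity ((2 * sg - 1 - t) ^+ 2 + 4 * (1 + t) * sg - (1 + t) ^+ 2); first by ring.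
by rewrite -s_sg s_sqr; ring.
Qed.

Lemma yt_sg : y * t = sg * (1 + t - sg).
Proof. by rewrite mulrBr -expr2 sg_sqr; ring. Qed.

Lemma t1y_sg : t * (1 - y) = (sg - 1) * (sg - t).
Proof. by rewrite mulrBr mulr1 [t * y]mulrC yt_sg; ring. Qed.

Lemma u_num_sg : 1 + t * t - 2 * (y * t) - (1 - t) * s = t * (t * (1 - y) * tau ^+ 2 * 2 * (1 - y)).
Proof.
transitivity (2 * (t * (1 - y) * tau) ^+ 2); last by ring.
by rewrite t1y_sg -mulrA sgt_tau mulr1 s_sg yt_sg; ring.
Qed.

Lemma u_sg : t * (1 - y) * tau ^+ 2 = (sg - 1) * tau.
Proof.
by rewrite t1y_sg -mulrA expr2 [(sg - t) * _]mulrA sgt_tau mul1r.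
Qed.

Lemma v_num_sg : (1 + t) * (1 + t) - 2 * (y * t) - (1 + t) * s = t * (y * (2 * (y * t * rho ^+ 2))).
Proof.
transitivity (2 * (y * t * rho) ^+ 2); last by ring.
have -> : y * t * rho = 1 + t - sg by rewrite yt_sg mulrAC sg_rho mul1r.
by rewrite s_sg yt_sg; ring.
Qed.

Lemma v_sg : y * t * rho ^+ 2 = (1 + t) * rho - 1.
Proof.
transitivity ((sg * rho) * ((1 + t) * rho - sg * rho)); first by rewrite yt_sg; ring.
by rewrite sg_rho mul1r.
Qed.

Variables (u v : R).
Hypotheses (uE : u = (sg - 1) * tau) (vE : v = (1 + t) * rho - 1).

Lemma uv_sg : 1 + u * v = (1 + u) * rho.
Proof.
have rho1 : 1 - rho = rho * (sg - 1) by rewrite mulrBr mulr1 [rho * _]mulrC sg_rho.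
have rhot : 1 - t * rho = rho * (sg - t).
  by rewrite mulrBr [rho * sg]mulrC sg_rho [rho * t]mulrC.
transitivity ((1 + u) * rho + (1 - rho) - u * (1 - t * rho)); first by rewrite vE; ring.
rewrite rho1 rhot uE.
transitivity ((1 + (sg - 1) * tau) * rho + rho * (sg - 1) * (1 - (sg - t) * tau)); first by ring.
by rewrite sgt_tau subrr mulr0 addr0.
Qed.

End SigmaIdentities.

Lemma riccati_closed_form (R : comNzRingType) (y t rho v w J : R) :
  v = y * t * rho ^+ 2 -> v = (1 + t) * rho - 1 -> (1 - v * w) * J = 1 ->
  w * (J ^+ 2 * (1 - v) ^+ 2) =
  1 + (1 + t) * (rho * (w - 1) * J) + y * t * (rho * (w - 1) * J) ^+ 2.
Proof.
move=> v1 v2 wJ.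
transitivity (((1 - v * w) * J) ^+ 2 + ((1 + t) * rho - 1 + 1) * (w - 1) * J * ((1 - v * w) * J)
  + y * t * rho ^+ 2 * ((w - 1) * J) ^+ 2); last by rewrite wJ; ring.
by rewrite -v1 -v2; ring.
Qed.

Lemma ps_mulE (f g : fps3) : ps_mul f g = f * g.
Proof. by apply: fps3P => n k d; rewrite mul3E. Qed.

Lemma ps_addE (f g : fps3) : ps_add f g = f + g. Proof. by []. Qed.

Lemma ps_oneE : ps_one = (1 : fps3). Proof. by rewrite /ps_one ps_constE cst1. Qed.

Lemma ps_scaleE c (f : fps3) : ps_scale c f = cst c * f.
Proof. by apply: fps3P => n k d; rewrite cstM. Qed.

Local Notation x3 := (mon3 1 0 0 1).
Local Notation y3 := (mon3 0 1 0 1).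
Local Notation t3 := (mon3 0 0 1 1).

Lemma ps_xE : ps_x = x3.
Proof. by apply: fps3P => n k d; rewrite mon3E /ps_x; case: ifP. Qed.
Lemma ps_yE : ps_y = y3.
Proof. by apply: fps3P => n k d; rewrite mon3E /ps_y; case: ifP. Qed.
Lemma ps_tE : ps_t = t3.
Proof. by apply: fps3P => n k d; rewrite mon3E /ps_t; case: ifP. Qed.

Lemma ps_div_tK (f : fps3) : ps_div_t (t3 * f) = f.
Proof. by apply: fps3P => n k d; rewrite /ps_div_t mon3M /= !subn0 subn1 mul1r. Qed.

Lemma ps_div_yK (f : fps3) : ps_div_y (y3 * f) = f.
Proof. by apply: fps3P => n k d; rewrite /ps_div_y mon3M /= !subn0 subn1 mul1r. Qed.

Definition psE := (ps_mulE, ps_subE, ps_addE, ps_oneE, ps_scaleE, ps_xE, ps_yE, ps_tE).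

Definition s3 : fps3 := ps_sqrt ((1 + t3) * (1 + t3) - 4 * (y3 * t3)).
Definition sigma : fps3 := cst 2^-1 * (s3 + 1 + t3).
Definition rho : fps3 := ps_inv sigma.
Definition tau : fps3 := ps_inv (sigma - t3).

Lemma sqrt_termE : sqrt_term = s3.
Proof. by rewrite /sqrt_term !psE (cst_nat 4). Qed.

Lemma half2 : 2 * cst 2^-1 = 1 :> fps3.
Proof. by rewrite -(cst_nat 2) -cst_mul divff // cst1. Qed.

Lemma t000 : t3 0 0 0 = 0. Proof. by rewrite mon3E. Qed.

Lemma s3_arg : ((1 + t3) * (1 + t3) - 4 * (y3 * t3)) 0 0 0 = 1.
Proof.
rewrite !fpsD !fpsN natrM3 !mul3_000 !fpsD t000 fps3_1 !mulr0 subr0 addr0.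
exact: mulr1.
Qed.

Lemma s3_sqr : s3 ^+ 2 = (1 + t3) * (1 + t3) - 4 * (y3 * t3).
Proof. exact: sqrt3_sqr s3_arg. Qed.

Lemma sigma000 : sigma 0 0 0 = 1.
Proof.
by rewrite /sigma /s3 cstM !fpsD t000 fps3_1 sqrt3_000 ?s3_arg // addr0 mulVf.
Qed.

Lemma sigma_rho : sigma * rho = 1. Proof. exact: ps_invP sigma000. Qed.

Lemma sigma_tau : (sigma - t3) * tau = 1.
Proof. by apply: ps_invP; rewrite !fpsD !fpsN sigma000 t000 subr0. Qed.

Local Notation u3 := (u_ps : fps3).
Local Notation v3 := (v_ps : fps3).
Local Notation w3 := (w_ps : fps3).

Lemma u_psE : u_ps = (sigma - 1) * tau :> fps3.
Proof.
have y1 : (1 - y3) * ps_inv (1 - y3) = 1.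
  by apply: ps_invP; rewrite !fpsD !fpsN fps3_1 mon3E subr0.
rewrite /u_ps !psE sqrt_termE (cst_nat 2).
rewrite (u_num_sg half2 s3_sqr erefl sigma_tau) -!mulrA y1 mulr1 ps_div_tK.
rewrite -(u_sg half2 s3_sqr erefl sigma_tau).
transitivity (2 * cst 2^-1 * (t3 * (1 - y3) * tau ^+ 2)); first by ring.
by rewrite half2 mul1r.
Qed.

Lemma v_psE : v_ps = y3 * t3 * rho ^+ 2 :> fps3.
Proof.
rewrite /v_ps !psE sqrt_termE (cst_nat 2) (v_num_sg half2 s3_sqr erefl sigma_rho).
rewrite ps_div_tK ps_div_yK.
transitivity (2 * cst 2^-1 * (y3 * t3 * rho ^+ 2)); first by ring.
by rewrite half2 mul1r.
Qed.

Lemma v_ps_rho : v_ps = (1 + t3) * rho - 1 :> fps3.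
Proof. by rewrite v_psE (v_sg half2 s3_sqr erefl sigma_rho). Qed.

Lemma uv_psE : 1 + u3 * v3 = (1 + u3) * rho.
Proof. exact: (uv_sg sigma_rho sigma_tau u_psE v_ps_rho). Qed.

Lemma uv000 : (1 + u3 * v3) 0 0 0 = 1.
Proof.
by rewrite v_psE !fpsD !mul3_000 t000 mulr0 !mul0r mulr0 fps3_1 addr0.
Qed.

Lemma w_psE : w_ps = ps_exp (x3 * (sigma * (1 - v3))).
Proof.
rewrite /w_ps !psE; apply: congr1; rewrite -mulrA; apply: congr1.
have := ps_invP uv000; rewrite uv_psE.
move: (ps_inv _ : fps3) => Q uQ.
transitivity (sigma * rho * ((1 + u3) * (1 - v3) * Q)).
  by rewrite sigma_rho mul1r.
transitivity ((1 + u3) * rho * Q * (sigma * (1 - v3))).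
  by ring.
by rewrite uQ mul1r.
Qed.

Definition J3 : fps3 := ps_inv (1 - v3 * w3).
Definition G3 : fps3 := rho * (w3 - 1) * J3.

Lemma vw000 : (1 - v3 * w3) 0 0 0 = 1.
Proof.
by rewrite v_psE !fpsD !fpsN !mul3_000 t000 mulr0 !mul0r fps3_1 subr0.
Qed.

Lemma vwJ : (1 - v3 * w3) * J3 = 1.
Proof. exact: ps_invP vw000. Qed.

Lemma log_argE : log_arg = 1 + (1 + t3) * G3.
Proof.
rewrite /log_arg !psE; apply: congr1.
rewrite (inv3_mul uv000 vw000) -/J3.
have := ps_invP uv000; move: (ps_inv (1 + u3 * v3) : fps3) => Q; rewrite uv_psE => uQ.
set lhs := (X in ps_div_t X).
have -> : lhs = t3 * (y3 * ((1 + t3) * G3)).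
  rewrite /lhs /G3.
  transitivity ((1 + t3) * (1 + u3) * (y3 * t3 * rho ^+ 2 * (w3 - 1)) * (Q * J3)).
    by rewrite -v_psE.
  transitivity ((1 + u3) * rho * Q * (t3 * (y3 * ((1 + t3) * (rho * (w3 - 1) * J3))))).
    by ring.
  by rewrite uQ mul1r.
by rewrite ps_div_tK ps_div_yK.
Qed.

Lemma euler_inv p q r (F : fps3) : F 0 0 0 = 1 -> euler p q r F = 0 ->
  euler p q r (ps_inv F) = 0.
Proof.
move=> F1 F0; rewrite /ps_inv ps_subE ps_constE cst1.
by rewrite (subst_euler (sub1_000 F1)) euler_sub1 F0 mul0r.
Qed.

Lemma euler_x_sigma : euler 1 0 0 sigma = 0.
Proof.
have et : euler 1 0 0 t3 = 0 by rewrite euler_mon3 cst0 mul0r.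
have ey : euler 1 0 0 y3 = 0 by rewrite euler_mon3 cst0 mul0r.
rewrite /sigma eulerM euler_cst mul0r add0r !eulerD et euler1 !addr0.
rewrite /s3 /ps_sqrt ps_subE ps_constE cst1 (subst_euler (sub1_000 s3_arg)) euler_sub1.
rewrite -(cst_nat 4) eulerD eulerN !eulerM !eulerD et ey euler1 euler_cst.
by rewrite !(mul0r, mulr0, addr0, oppr0).
Qed.

Lemma euler_x_rho : euler 1 0 0 rho = 0.
Proof. exact: euler_inv sigma000 euler_x_sigma. Qed.

Lemma euler_x_v : euler 1 0 0 v_ps = 0.
Proof.
rewrite v_ps_rho eulerD eulerN eulerM eulerD euler_x_rho euler1 euler_mon3 cst0.
by rewrite !(mul0r, mulr0, addr0, oppr0).
Qed.

Lemma w_arg000 : (x3 * (sigma * (1 - v3))) 0 0 0 = 0.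
Proof. by rewrite mon3M. Qed.

Lemma euler_x_w : euler 1 0 0 w_ps = x3 * (sigma * (1 - v3)) * w3.
Proof.
rewrite {1}w_psE (exp_euler _ _ _ w_arg000) -w_psE; apply: (congr1 ( *%R^~ _)).
rewrite eulerM (eulerM 1 0 0 sigma) euler_x_sigma eulerD eulerN euler_x_v euler1 euler_mon3.
rewrite (cst_nat 1).
by rewrite !(mul0r, mulr0, addr0, oppr0, mul1r).
Qed.

Lemma G3_riccati : euler 1 0 0 G3 = x3 * (1 + (1 + t3) * G3 + y3 * t3 * G3 ^+ 2).
Proof.
rewrite /G3 -(riccati_closed_form v_psE v_ps_rho vwJ).
have eJ : euler 1 0 0 J3 = J3 ^+ 2 * v3 * euler 1 0 0 w_ps.
  have : euler 1 0 0 ((1 - v3 * w3) * J3) = 0 by rewrite vwJ euler1.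
  rewrite eulerM eulerD eulerN eulerM euler1 euler_x_v => eq0.
  transitivity ((1 - v3 * w3) * J3 * euler 1 0 0 J3).
    by rewrite vwJ mul1r.
  transitivity (J3 * ((0 - (0 * w3 + v3 * euler 1 0 0 w_ps)) * J3
      + (1 - v3 * w3) * euler 1 0 0 J3) + J3 ^+ 2 * v3 * euler 1 0 0 w_ps); first by ring.
  by rewrite eq0 mulr0 add0r.
rewrite !eulerM eulerD eulerN euler1 euler_x_rho eJ euler_x_w.
move: sigma_rho vwJ; move: v3 w3 J3 sigma rho => v w J sg rh sr wJ.
transitivity (sg * rh * (x3 * w * (1 - v)) *
    (J * ((1 - v * w) * J) + J ^+ 2 * v * (w - 1))); first by rewrite wJ; ring.
by rewrite sr; ring.
Qed.

Lemma riccati_unique (F G : fps3) : F 0%N = 0 -> G 0%N = 0 ->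
  euler 1 0 0 F = x3 * (1 + (1 + t3) * F + y3 * t3 * F ^+ 2) ->
  euler 1 0 0 G = x3 * (1 + (1 + t3) * G + y3 * t3 * G ^+ 2) -> F = G.
Proof.
move=> F0 G0 eF eG; apply/eqP; rewrite -subr_eq0; apply/eqP.
set H := F - G; pose A := (1 + t3) + y3 * t3 * (F + G).
have eH : euler 1 0 0 H = x3 * (A * H).
  by rewrite eulerD eulerN eF eG /H /A; ring.
have x1 : x3 = mon 1 1 by rewrite /mon3 !mon1.
suff Hn n : H n = 0 by apply: funext => n; rewrite Hn.
elim/ltn_ind: n => -[|n] IHn; first by rewrite /H fpsD fpsN F0 G0 subrr.
apply: funext => k; apply: funext => d; rewrite !fps0.
have := congr1 (fun f : fps3 => f n.+1 k d) eH.
rewrite /euler x1 monM subn1 /= mul1r fpsM big1 => [/eqP|i _]; last first.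
  by rewrite IHn ?mulr0 // ltnS leq_subr.
by rewrite !fps0 mulf_eq0 pnatr_eq0 mul1n /= => /eqP.
Qed.

Lemma G3_0 : G3 0%N = 0.
Proof.
rewrite /G3 w_psE /ps_exp (substS w_arg000) cst1.
set S := (ps_subst _ _ : fps3).
have -> : rho * (1 + x3 * (sigma * (1 - v3)) * S - 1) * J3 =
   x3 * (rho * (sigma * (1 - v3)) * S * J3) by ring.
by rewrite monM.
Qed.

Theorem theorem3p5 :
  forall n k d : nat, B_pkdes n k d = ps_exp (D_tx (ps_ln log_arg)) n k d.
Proof.
move=> n k d; rewrite B_pkdes_exp_ln log_argE.
by rewrite (riccati_unique perm_egf0 G3_0 perm_egf_riccati G3_riccati).
Qed.
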